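(* Let $\{X_j\}_{j\ge 0}$ be a (strictly) stationary sequence of real random variables with a regenerative structure $\{(W_i,Y_i)\}_{i\ge 0}$ as described in the context. If $\mu=\mathbb{E}W_1<+\infty$ and $$\mathbb{P}\Big(Y_0>\max_{1\le j\le n}Y_j\Big)\to 0\quad\text{as } n\to\infty,$$ then $\{X_j\}$ admits a continuous phantom distribution function if, and only if, the distribution function of $Y_1$ is regular. In such a case $G(x)=\big(\mathbb{P}(Y_1\le x)\big)^{1/\mu}$ is a regular phantom distribution function for $\{X_j\}$.
   Context: Regenerative structure: there exist integer-valued random variables $0<S_0<S_1<S_2<\cdots$ (regeneration times). Put $W_0=S_0$, $W_i=S_i-S_{i-1}$ for $i\ge 1$ (cycle lengths), and $Y_0=\max_{0\le j<S_0}X_j$, $Y_i=\max_{S_{i-1}\le j<S_i}X_j$ for $i\ge 1$ (maxima over the cycles). It is assumed that $(W_0,Y_0),(W_1,Y_1),(W_2,Y_2),\dots$ are independent and that $(W_1,Y_1),(W_2,Y_2),\dots$ are identically distributed. $M_n=\max_{1\le j\le n}X_j$. A distribution function $G$ is a phantom distribution function for the stationary sequence $\{X_j\}$ if $\sup_{u\in\mathbb{R}}|\mathbb{P}(M_n\le u)-G^n(u)|\to 0$ as $n\to\infty$, where $G^n(u)=(G(u))^n$. For a distribution function $G$, its right end is $G_*=\sup\{x: G(x)<1\}$. $G$ is called regular (in the sense of O'Brien) if $G(G_*-)=1$ and $\lim_{x\to G_*-}\frac{1-G(x-)}{1-G(x)}=1$, where $G(x-)$ denotes the left limit at $x$. 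*)

(* Defs.v *)
From HB Require Import structures.
From mathcomp Require Import all_boot all_order all_algebra finmap.
From mathcomp Require Import all_classical all_reals all_analysis.

Set Implicit Arguments.
Unset Strict Implicit.
Unset Printing Implicit Defensive.
Import Order.TTheory GRing.Theory Num.Theory.
Import numFieldNormedType.Exports.
Local Open Scope classical_set_scope.
Local Open Scope ring_scope.

(* Maximum of [x j] over [a <= j < b]. The base value [x a] only matters when
   the range is empty. *)
Definition max_on (R : realType) (x : nat -> R) (a b : nat) : R :=
  \big[Num.max/x a]_(a <= j < b) x j.

Section Processes.
Context (d : measure_display) (T : measurableType d) (R : realType)
  (P : probability T R).

Definition strictly_stationary (X : nat -> {RV P >-> R}) : Prop :=
  forall (n k : nat) (B : set (n.-tuple R)), measurable B ->
    P [set w | B [tuple X (k + i)%N w | i < n]] =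
    P [set w | B [tuple X i w | i < n]].

Definition mutually_independent (d' : measure_display) (T' : measurableType d')
    (I : choiceType) (Z : I -> T -> T') : Prop :=
  forall (J : {fset I}) (B : I -> set T'),
    (forall i, i \in J -> measurable (B i)) ->
    P (\bigcap_(i in [set` J]) Z i @^-1` B i) =
    (\prod_(i <- J) P (Z i @^-1` B i))%E.

Definition same_law (d' : measure_display) (T' : measurableType d')
    (Z1 Z2 : T -> T') : Prop :=
  forall B : set T', measurable B -> P (Z1 @^-1` B) = P (Z2 @^-1` B).

Definition cycle_length (S : nat -> {RV P >-> nat}) (i : nat) (w : T) : nat :=
  if i is j.+1 then (S j.+1 w - S j w)%N else S 0%N w.

Definition cycle_max (X : nat -> {RV P >-> R}) (S : nat -> {RV P >-> nat})
    (i : nat) (w : T) : R :=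
  if i is j.+1 then max_on (X ^~ w) (S j w) (S j.+1 w)
  else max_on (X ^~ w) 0 (S 0%N w).

Definition regenerative (X : nat -> {RV P >-> R}) (S : nat -> {RV P >-> nat}) :
    Prop :=
  let Z i w := (cycle_length S i w, cycle_max X S i w) in
  [/\ forall w, (0 < S 0 w)%N,
      forall i w, (S i w < S i.+1 w)%N,
      mutually_independent Z &
      forall i, (1 <= i)%N -> same_law (Z i) (Z 1%N)].

Definition distr_fun (Y : T -> R) (x : R) : R := fine (P [set w | Y w <= x]).

End Processes.

Section DistributionFunctions.
Context (R : realType).

(* The conditions of the library's type [cumulativeBounded 0 1]. *)
Definition is_distr_fun (G : R -> R) : Prop :=
  [/\ nondecreasing G, right_continuous G,
      G x @[x --> -oo] --> (0 : R) & G x @[x --> +oo] --> (1 : R)].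

Definition phantom_distr_fun (d : measure_display) (T : measurableType d)
    (P : probability T R) (X : nat -> {RV P >-> R}) (G : R -> R) : Prop :=
  is_distr_fun G /\
  sup [set `|fine (P [set w | max_on (X ^~ w) 1 n.+1 <= u]) - G u ^+ n|
      | u in [set: R]] @[n --> \oo] --> (0 : R).

Definition right_end (G : R -> R) : \bar R :=
  ereal_sup [set x%:E | x in [set x | G x < 1]].

(* Left neighbourhoods, in [R], of an extended real. The value at [-oo] is
   arbitrary: the right end of a distribution function is never [-oo]. *)
Definition left_nbhs (e : \bar R) : set_system R :=
  match e with
  | r%:E => r^'-
  | +oo%E => +oo
  | -oo%E => -oo
  end.

Definition left_lim (G : R -> R) (x : R) : R := lim (G y @[y --> x^'-]).

Definition regular_distr_fun (G : R -> R) : Prop :=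
  G x @[x --> left_nbhs (right_end G)] --> (1 : R) /\
  (1 - left_lim G x) / (1 - G x) @[x --> left_nbhs (right_end G)] --> (1 : R).

End DistributionFunctions.

(* Main.v *)
Require Import Defs.
From HB Require Import structures.
From mathcomp Require Import all_boot all_order all_algebra finmap.
From mathcomp Require Import all_classical all_reals all_analysis.
From mathcomp Require Import measurable_realfun.
From mathcomp Require Import ring lra.

(* With H the distribution function of Y_1, the maximum of X_0, ..., X_{S_k - 1}
   is max(Y_0, ..., Y_k).  By the weak law of large numbers S_k is close to mu k,
   and Y_0 does not matter by hypothesis, so P(M_n <= u) is squeezed between
   H(u)^k for k slightly above and slightly below n / mu; since
   |x^a - x^b| <= (b - a) / a on [0, 1], G = H^(1/mu) is always a phantom
   distribution function.  The theorem is then about powers only: a distribution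
   function G is regular iff sup_u |F(u)^n - G(u)^n| -> 0 for some continuous
   distribution function F.  If such an F exists, then G^n has jumps of size
   o(1); at a point x where n is chosen so that G(x)^n is in [1/4, 1/2], a jump
   of G is thus o(1/n), that is o(1 - G(x)).  Conversely a regular G is
   tail equivalent to a sum F of continuous ramps, each of which lies just to
   the left of a quantile of G.  Closeness of n-th powers is stable under
   F, G |-> F^a, G^a, which transfers everything between G and H. *)

Set Implicit Arguments.
Unset Strict Implicit.
Unset Printing Implicit Defensive.
Import Order.TTheory GRing.Theory Num.Theory.
Import numFieldNormedType.Exports.
Local Open Scope classical_set_scope.
Local Open Scope ring_scope.

(** * Regular distribution functions *)

(** The supremum over [u] demands estimates uniform in [u]. In the sandwich this holds because the
    exceptional events, [S_k] far from [mu k] and [Y_0] above the later cycle maxima, do not mention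
    [u]; as they enter through a union bound only, the dependence between the length and the maximum
    of one cycle does no harm. For powers, uniformity comes from a trade-off: where [1 - G = t], a
    relative error [e] in the tail [t] changes [G^n] by about [n e t exp(- n t)], which is of order
    [e] whatever [n] and [t] are. Closeness of [n]-th powers thus measures relative precision in the
    tail, which is why the answer is a condition on ratios of tails. It also explains the quantile
    levels [1 - 1 / (k + 2)] of the ramps: the ratios of successive tails tend to 1, so that
    interpolating between these levels costs no relative precision in the limit. *)

Section DistributionFunctionTails.
Context (R : realType).
Implicit Types (F G : R -> R) (e : \bar R) (x y : R).

Lemma distr_fun_itv G x : is_distr_fun G -> 0 <= G x <= 1.
Proof.
case=> ndG _ G0 G1; apply/andP; split.
- apply: (cvgr_to_le G0); exists x; split=> [|y yx]; first exact: num_real.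
  exact/ndG/ltW.
- apply: (cvgr_to_ge G1); exists x; split=> [|y xy]; first exact: num_real.
  exact/ndG/ltW.
Qed.

Lemma nondecreasing_lt G x y : nondecreasing G -> G x < G y -> x < y.
Proof.
by move=> ndG; apply: contraTT; rewrite -!leNgt; exact: ndG.
Qed.

Lemma left_nbhs_proper e : ProperFilter (left_nbhs e).
Proof. by case: e => [r| |] /=; typeclasses eauto. Qed.

(** A common description for finite and infinite right ends, so that later arguments need not split
    on the two cases. *)
Lemma near_left_nbhsP e (A : set R) : e != -oo%E ->
  left_nbhs e A <->
  exists2 x0 : R, (x0%:E < e)%E & forall x, x0 < x -> (x%:E < e)%E -> A x.
Proof.
case: e => [r| |]//= _; split.
- case=> d /= d0 dA; exists (r - d); first by rewrite lte_fin ltrBlDr ltrDl.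
  move=> x rdx; rewrite lte_fin => xr; apply: dA => //=.
  by rewrite gtr0_norm ?subr_gt0// ltrBlDr -ltrBlDl.
- case=> x0; rewrite lte_fin => x0r x0A.
  near=> x; apply: x0A; rewrite ?lte_fin; near: x.
  + exact: nbhs_left_gt.
  + exact: nbhs_left_lt.
- by case=> M [_ MA]; exists M => [|x Mx _]; [exact: ltry|exact: MA].
- case=> M _ MA; exists M; split=> [|x Mx]; first exact: num_real.
  by apply: MA => //; exact: ltry.
Unshelve. all: by end_near. Qed.

Lemma cvg_left_nbhsP e (f : R -> R) (l : R) : e != -oo%E ->
  f x @[x --> left_nbhs e] --> l <->
  forall eps, 0 < eps -> exists2 x0 : R, (x0%:E < e)%E &
    forall x, x0 < x -> (x%:E < e)%E -> `|l - f x| < eps.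
Proof.
move=> eNy; have ? := left_nbhs_proper e; split.
- by move=> /cvgrPdist_lt fl eps /fl/(near_left_nbhsP _ eNy).
- by move=> fl; apply/cvgrPdist_lt => eps /fl/(near_left_nbhsP _ eNy).
Qed.

Lemma lt_right_endP G x :
  (x%:E < right_end G)%E <-> exists2 y, x < y & G y < 1.
Proof.
split=> [/ereal_sup_gt[_ [y Gy <-]]|[y xy Gy]].
  by rewrite lte_fin => xy; exists y.
apply: (@lt_le_trans _ _ y%:E); first by rewrite lte_fin.
by apply: ereal_sup_ubound; exists y.
Qed.

Lemma right_end_neqNy G : is_distr_fun G -> right_end G != -oo%E.
Proof.
case=> _ _ /cvgrPdist_lt/(_ 1 ltr01)[M [_ MG]] _.
have /MG : M - 1 < M by rewrite ltrBlDr ltrDl.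
rewrite sub0r normrN => /ltr_normlW GM1.
apply/eqP => eNy.
have /lt_right_endP : exists2 y, M - 2 < y & G y < 1.
  by exists (M - 1) => //; rewrite ltrD2l ltrN2 ltr1n.
by rewrite eNy ltNge leNye.
Qed.

Section LeftLimit.
Variables (G : R -> R).
Hypothesis ndG : nondecreasing G.

Lemma is_cvg_left_lim x : cvg (G y @[y --> x^'-]).
Proof.
apply: nondecreasing_at_left_is_cvgr.
- by near=> z => a b _ _; exact: ndG.
- near=> z; exists (G x) => _ [y /= + <-]; rewrite in_itv/= => /andP[_ yx].
  exact/ndG/ltW.
Unshelve. all: by end_near. Qed.

Lemma left_lim_le x : left_lim G x <= G x.
Proof.
apply: limr_le; first exact: is_cvg_left_lim.
by near=> y; apply/ndG/ltW; near: y; exact: nbhs_left_lt.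
Unshelve. all: by end_near. Qed.

Lemma le_left_lim x y : y < x -> G y <= left_lim G x.
Proof.
move=> yx; apply: limr_ge; first exact: is_cvg_left_lim.
by near=> z; apply/ndG/ltW; near: z; exact: nbhs_left_gt.
Unshelve. all: by end_near. Qed.

Lemma lt_left_lim x c : c < left_lim G x -> exists2 y, y < x & c < G y.
Proof.
move=> cG; apply: contrapT => nex; move: cG; rewrite ltNge; apply/negP/negPn.
apply: limr_le; first exact: is_cvg_left_lim.
near=> y; rewrite leNgt; apply/negP => cy; apply: nex; exists y => //.
Unshelve. all: by end_near. Qed.

End LeftLimit.

(** O'Brien's conditions freed of filters. Only levels of [G] are quantified over, so the right end
    does not appear; a point [y < x] stands in for the left limit at [x]. *)
Definition tail_regular G : Prop :=
  (forall eps, 0 < eps -> exists x, 1 - eps < G x < 1) /\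
  (forall eps, 0 < eps -> exists2 s, 0 < s & forall x, 1 - s <= G x < 1 ->
     exists2 y, y < x & 1 - G y <= (1 + eps) * (1 - G x)).

Lemma tail_regularP G : is_distr_fun G -> regular_distr_fun G <-> tail_regular G.
Proof.
move=> dG; have [ndG _ _ _] := dG; have eNy := right_end_neqNy dG.
have G1 x : G x <= 1 by have /andP[] := distr_fun_itv x dG.
have ltG x : (x%:E < right_end G)%E -> G x < 1.
  by move=> /lt_right_endP[y xy]; apply: le_lt_trans; exact/ndG/ltW.
have Glt x : G x < 1 -> (x%:E <= right_end G)%E.
  by move=> Gx; apply: ereal_sup_ubound; exists x.
rewrite /regular_distr_fun !cvg_left_nbhsP//; split.
- case=> lim1 limq; split=> eps eps0.
    have [x0 x0e x0G] := lim1 _ eps0.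
    have [y x0y Gy] := (lt_right_endP _ _).1 x0e.
    have [z /andP[x0z zy]] : exists z, x0 < z < y.
      by exists ((x0 + y) / 2); rewrite !midf_lt.
    have Gz1 : G z < 1 by rewrite (le_lt_trans _ Gy)//; exact/ndG/ltW.
    exists z; rewrite Gz1 andbT.
    have /x0G : (z%:E < right_end G)%E by apply/lt_right_endP; exists y.
    by move=> /(_ x0z); rewrite gtr0_norm ?subr_gt0// ltrBlDl addrC -ltrBlDl.
  have eps20 : 0 < eps / 2 by rewrite divr_gt0.
  have [x0 x0e x0G] := limq _ eps20.
  have [y x0y Gy] := (lt_right_endP _ _).1 x0e.
  exists ((1 - G y) / 2); first by rewrite divr_gt0// subr_gt0.
  move=> x /andP[sx Gx].
  have yx : y < x by apply: (nondecreasing_lt ndG); lra.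
  (* If [x] were the right end, [G] would stay below [G x < 1] on its left, against [lim1]. *)
  have xe : (x%:E < right_end G)%E.
    rewrite lt_neqAle Glt// andbT; apply/eqP => xe.
    have [x1 x1e x1G] := lim1 (1 - G x) ltac:(rewrite subr_gt0//).
    move: x1e; rewrite -xe lte_fin => x1x.
    have := x1G ((x1 + x) / 2) (midf_lt x1x).1.
    rewrite -xe lte_fin => /(_ (midf_lt x1x).2).
    have := ndG _ _ (ltW (midf_lt x1x).2).
    by have := ler_norm (1 - G ((x1 + x) / 2)); lra.
  have := x0G x (lt_trans x0y yx) xe.
  rewrite distrC => /(le_lt_trans (ler_norm _)).
  rewrite ltrBlDr ltr_pdivrMr ?subr_gt0// => Gl.
  have [|z zx cz] := @lt_left_lim _ ndG x (1 - (1 + eps) * (1 - G x)).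
    by nra.
  by exists z => //; lra.
- case=> ex1 exy; split=> eps eps0.
    have [x1 /andP[x1G Gx1]] := ex1 _ eps0.
    have [x2 /andP[x2G Gx2]] : exists x, 1 - (1 - G x1) < G x < 1.
      by apply: ex1; rewrite subr_gt0.
    exists x1.
      apply/lt_right_endP; exists x2 => //; apply: (nondecreasing_lt ndG); lra.
    move=> x x1x _; rewrite ger0_norm ?subr_ge0//.
    by have := ndG _ _ (ltW x1x); lra.
  have eps20 : 0 < eps / 2 by rewrite divr_gt0.
  have [s s0 sG] := exy _ eps20.
  have [x1 /andP[x1G Gx1]] := ex1 _ s0.
  have [x2 /andP[x2G Gx2]] : exists x, 1 - (1 - G x1) < G x < 1.
    by apply: ex1; rewrite subr_gt0.
  exists x1.
    apply/lt_right_endP; exists x2 => //; apply: (nondecreasing_lt ndG); lra.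
  move=> x x1x xe; have Gx := ltG _ xe.
  have [|y yx Gy] := sG x.
    by rewrite Gx andbT; have := ndG _ _ (ltW x1x); lra.
  have := left_lim_le ndG x; have := le_left_lim ndG yx => lG Gl.
  have ratio_ge1 : 1 <= (1 - left_lim G x) / (1 - G x).
    by rewrite ler_pdivlMr ?subr_gt0// mul1r; lra.
  have ratio_le : (1 - left_lim G x) / (1 - G x) <= 1 + eps / 2.
    by rewrite ler_pdivrMr ?subr_gt0//; lra.
  by rewrite distrC ger0_norm ?subr_ge0//; lra.
Qed.

End DistributionFunctionTails.

(** * Uniform closeness of powers *)

Section ClosePowers.
Context (R : realType).
Implicit Types (F G : R -> R) (p q x y : R).

Definition close_powers F G : Prop := forall eps : R, 0 < eps ->
  \forall n \near \oo, forall u, `|F u ^+ n - G u ^+ n| <= eps.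

(** [q ^+ n.+1 - p ^+ n.+1] is [q - p] times a sum of [n.+1] monomials of degree [n] in [p] and [q],
    each between [p ^+ n] and [q ^+ n]. For [q = 1] the upper bound is Bernoulli's inequality. *)
Lemma subX_itv p q n : 0 <= p -> p <= q ->
  n.+1%:R * (q - p) * p ^+ n <= q ^+ n.+1 - p ^+ n.+1 <=
  n.+1%:R * (q - p) * q ^+ n.
Proof.
move=> p0 pq; elim: n => [|n /andP[IHl IHr]].
  by rewrite !expr0 !mulr1 !expr1 mul1r !lexx.
have q0 := le_trans p0 pq.
have -> : q ^+ n.+2 - p ^+ n.+2 =
    q * (q ^+ n.+1 - p ^+ n.+1) + (q - p) * p ^+ n.+1.
  by rewrite !exprS; ring.
have qn0 : 0 <= q ^+ n.+1 - p ^+ n.+1 by rewrite subr_ge0 lerXn2r ?nnegrE.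
rewrite -!(natr1 n.+1) !exprS.
have := ler_wpM2l p0 IHl; have := ler_wpM2l q0 IHr.
have : p * (q ^+ n.+1 - p ^+ n.+1) <= q * (q ^+ n.+1 - p ^+ n.+1).
  exact: ler_wpM2r.
have : (q - p) * p ^+ n.+1 <= (q - p) * q ^+ n.+1.
  by rewrite ler_wpM2l ?subr_ge0// lerXn2r ?nnegrE.
rewrite !exprS => h1 h2 h3 h4; apply/andP; split; nra.
Qed.

Lemma near_exprn_le p eps : 0 <= p -> p < 1 -> 0 < eps ->
  \forall n \near \oo, p ^+ n <= eps.
Proof.
move=> p0 p1 eps0; have : p ^+ n @[n --> \oo] --> (0 : R).
  by apply: cvg_expr; rewrite ger0_norm.
move=> /cvgrPdist_le/(_ _ eps0); apply: filterS => n.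
by rewrite sub0r normrN ger0_norm// exprn_ge0.
Qed.

Lemma continuous_power F n : continuous F -> continuous (fun x => F x ^+ n).
Proof.
move=> cF x; apply: (@continuous_comp _ _ _ F (fun y => y ^+ n)); first exact: cF.
exact: exprn_continuous.
Qed.

Lemma continuous_distr_fun_surj F n v : continuous F -> is_distr_fun F ->
  0 < v < 1 -> exists x, F x ^+ n.+1 = v.
Proof.
move=> cF [ndF _ F0 F1] /andP[v0 v1].
have cFn := @continuous_power F n.+1 cF.
have /cvgrPdist_lt/(_ _ v0)[a [_ Fa]] : F x ^+ n.+1 @[x --> -oo] --> (0 : R).
  rewrite -[X in _ --> X](expr0n _ n.+1).
  apply: (@cvg_comp _ _ _ F (fun y => y ^+ n.+1) _ _ _ F0).
  exact: exprn_continuous.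
have v1' : 0 < 1 - v by rewrite subr_gt0.
have /cvgrPdist_lt/(_ _ v1')[b [_ Fb]] : F x ^+ n.+1 @[x --> +oo] --> (1 : R).
  rewrite -[X in _ --> X](expr1n _ n.+1).
  apply: (@cvg_comp _ _ _ F (fun y => y ^+ n.+1) _ _ _ F1).
  exact: exprn_continuous.
set a' := Num.min a b - 1; set b' := Num.max a b + 1.
have a'a : a' < a.
  by rewrite ltrBlDr (@le_lt_trans _ _ a) ?ltrDl// ge_min lexx.
have bb' : b < b' by rewrite (@le_lt_trans _ _ (Num.max a b)) ?ltrDl// le_max lexx orbT.
have a'b' : a' <= b'.
  apply: (le_trans (ltW a'a)); rewrite (@le_trans _ _ (Num.max a b)) ?lerDl//.
  by rewrite le_max lexx.
have [||c _ cv] := @IVT _ (fun x => F x ^+ n.+1) a' b' v a'b'.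
- by apply: continuous_subspaceT => x; exact: cFn.
- apply/andP; split.
    rewrite ge_min; apply/orP; left; apply/ltW.
    by have := Fa _ a'a; rewrite sub0r normrN; exact/le_lt_trans/ler_norm.
  rewrite le_max; apply/orP; right; apply/ltW.
  by have := Fb _ bb'; have := ler_norm (1 - F b' ^+ n.+1); lra.
by exists c.
Qed.

(* For the ratio condition, [n] is the least integer with [G x ^+ n <= 1 / 2], so
   that [G x ^+ n] stays above [1 / 4] and [1 - G x] is at least [1 / (2 n)]. *)
Lemma close_powers_tail_regular F G : continuous F -> is_distr_fun F ->
  is_distr_fun G -> close_powers F G -> tail_regular G.
Proof.
move=> cF dF dG FG; have G01 x := distr_fun_itv x dG.
split=> eps eps0.
- wlog eps1 : eps eps0 / eps < 1.
    move=> H; have [/H|eps1] := ltP eps 1; first exact.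
    have [||x /andP[Gx1 Gx]] := H (1 / 2); [lra|lra|].
    by exists x; rewrite Gx andbT; lra.
  have p0 : 0 <= 1 - eps by lra.
  have p1 : 1 - eps < 1 by lra.
  have /filter_ex[[|n] [//= _ pn FGn]] : \forall n \near \oo,
      [/\ (0 < n)%N, (1 - eps) ^+ n <= 1 / 8 &
          forall u, `|F u ^+ n - G u ^+ n| <= 1 / 4].
    near=> n; split; near: n.
    + exact: nbhs_infty_gt.
    + by apply: near_exprn_le => //; lra.
    + by apply: FG; lra.
  (* Where [F ^+ n.+1] is 1/2, [G ^+ n.+1] lies in [1/4, 3/4], which excludes both [G x <= 1 - eps]
     and [G x = 1]. *)
  have [|x Fx] := @continuous_distr_fun_surj F n (1 / 2) cF dF; first lra.
  exists x; have := FGn x; rewrite Fx ler_norml => /andP[l1 l2].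
  have /andP[G0 G1] := G01 x.
  apply/andP; split.
    rewrite ltNge; apply/negP => Gx.
    have : G x ^+ n.+1 <= (1 - eps) ^+ n.+1 by rewrite lerXn2r ?nnegrE.
    lra.
  rewrite lt_neqAle G1 andbT; apply/eqP => Gx.
  by move: l1 l2; rewrite Gx expr1n; lra.
(* Three errors [del] bound the drop of [G ^+ n.+1] from [x] to [y]. Since 1/4 - 3/16 = 1/16, its
   value at [y] is still at least 1/16; dividing by it turns [3 * del] into
   [48 * del <= eps / 2]. *)
- have del0 : 0 < Num.min (1 / 16) (eps / 96) by rewrite lt_min; lra.
  set del := Num.min _ _ in del0.
  have del16 : del <= 1 / 16 by rewrite ge_min lexx.
  have deleps : del <= eps / 96 by rewrite ge_min lexx orbT.
  have [N _ FGN] := FG del del0.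
  have N0 : 0 < N.+1%:R :> R by rewrite ltr0n.
  (* Bernoulli's inequality will give [n.+1 * (1 - q) >= 1 / 2]; a tail [1 - q] this small then
     forces [N <= n.+1]. *)
  exists (2 * N.+1%:R)^-1; first by rewrite invr_gt0 mulr_gt0.
  move=> x /andP[sq q1]; have /andP[q0 _] := G01 x.
  set q := G x in sq q1 q0 *.
  have sN : (1 - q) * N.+1%:R <= 1 / 2.
    rewrite -ler_pdivlMr// (le_trans (_ : _ <= (2 * N.+1%:R)^-1))//.
      by rewrite lerBlDr -lerBlDl.
    by rewrite invfM mulrC div1r mulrC.
  have q2 : 1 / 2 <= q.
    have : 1 <= N.+1%:R :> R by rewrite ler1n.
    by nra.
  have /filter_ex exn : \forall n \near \oo, q ^+ n <= 1 / 2.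
    by apply: near_exprn_le => //; lra.
  case: (ex_minnP exn) => -[|n] qn nmin; first by move: qn; rewrite expr0; lra.
  have qn' : 1 / 2 < q ^+ n by rewrite ltNge; apply/negP => /nmin; rewrite ltnn.
  have := subX_itv n q0 (ltW q1).
  rewrite !expr1n mulr1 => /andP[_ bern].
  have Nn : (N <= n.+1)%N.
    rewrite leqNgt; apply/negP => nN.
    have : n.+1%:R < N.+1%:R :> R by rewrite ltr_nat ltnS ltnW.
    by nra.
  have [y [yx Fy]] : exists y, y < x /\ `|F x ^+ n.+1 - F y ^+ n.+1| <= del.
    apply: (@filter_ex _ x^'-); near=> y; split=> //; near: y.
    have /cvgrPdist_le/(_ _ del0) := @continuous_power F n.+1 cF x.
    exact: cvg_within.
  exists y => //; have [ndG _ _ _] := dG.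
  have pq : G y <= q by exact/ndG/ltW.
  have /andP[p0 _] := G01 y; set p := G y in pq p0 *.
  have := FGN _ Nn x; have := FGN _ Nn y; rewrite -/p -/q.
  move: Fy; rewrite !ler_norml => /andP[_ l1] /andP[_ l2] /andP[l3 _].
  have qpn : q ^+ n.+1 - p ^+ n.+1 <= 3 * del by lra.
  have qn4 : 1 / 4 <= q ^+ n.+1 by rewrite exprS; nra.
  have pn16 : 1 / 16 <= p ^+ n.+1 by lra.
  have p1 : p <= 1 by rewrite (le_trans pq)// ltW.
  have pnS : p ^+ n.+1 <= p ^+ n by rewrite exprS ler_piMl// exprn_ge0.
  have /andP[subl _] := subX_itv n p0 pq.
  have nn0 : 0 < n.+1%:R :> R by rewrite ltr0n.
  have npq : n.+1%:R * (q - p) <= 48 * del.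
    have : 0 <= n.+1%:R * (q - p) by rewrite mulr_ge0// subr_ge0.
    by nra.
  have : n.+1%:R * (q - p) <= n.+1%:R * (eps * (1 - q)) by nra.
  by rewrite ler_pM2l//; lra.
Unshelve. all: by end_near. Qed.

End ClosePowers.

Local Arguments harmonic : simpl never.

(** * Continuous sums of ramps *)

Section ContinuousApproximation.
Context (R : realType).
Implicit Types (F G : R -> R) (x z : nat -> R).

Definition ramp (z x u : R) : R := Num.min 1 (Num.max 0 ((u - z) / (x - z))).

Lemma continuous_ramp (z x : R) : continuous (ramp z x).
Proof.
move=> u.
have clin : {for u, continuous (fun v => (v - z) / (x - z))}.
  apply: cvgM; last exact: cvg_cst.
  by apply: cvgB; [exact: cvg_id|exact: cvg_cst].
apply: (@continuous_min R R (cst 1) (fun v => Num.max 0 ((v - z) / (x - z)))).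
  exact: cst_continuous.
apply: (@continuous_max R R (cst 0) (fun v => (v - z) / (x - z))) => //.
exact: cst_continuous.
Qed.

Lemma ramp_itv (z x u : R) : 0 <= ramp z x u <= 1.
Proof. by rewrite /ramp le_min ler01 le_max lexx ge_min lexx. Qed.

Lemma nondecreasing_ramp (z x : R) : z < x -> nondecreasing (ramp z x).
Proof.
move=> zx u v uv; rewrite /ramp le_min ge_min lexx/= ge_min; apply/orP; right.
rewrite ge_max !le_max lexx/=; apply/orP; right.
by rewrite ler_pM2r ?invr_gt0 ?subr_gt0// lerB.
Qed.

Lemma ramp0 (z x u : R) : z < x -> u <= z -> ramp z x u = 0.
Proof.
move=> zx uz; rewrite /ramp (@max_l _ _ 0) ?min_r//.
by rewrite ler_pdivrMr ?subr_gt0// mul0r subr_le0.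
Qed.

Lemma ramp1 (z x u : R) : z < x -> x <= u -> ramp z x u = 1.
Proof.
move=> zx xu; rewrite /ramp min_l// le_max; apply/orP; right.
by rewrite ler_pdivlMr ?subr_gt0// mul1r lerB.
Qed.

(* The weights telescope: [1 / ((k + 1) (k + 2)) = 1 / (k + 1) - 1 / (k + 2)]. *)
Definition ramp_series z x (n : nat) (u : R) : R :=
  \sum_(k < n) (harmonic k - harmonic k.+1) * ramp (z k) (x k) u.

Definition ramp_sum z x (u : R) : R := limn (fun n => ramp_series z x n u).

Lemma ramp_series0 z x u : ramp_series z x 0 u = 0.
Proof. by rewrite /ramp_series big_ord0. Qed.

Lemma ramp_seriesS z x n u : ramp_series z x n.+1 u =
  ramp_series z x n u + (harmonic n - harmonic n.+1) * ramp (z n) (x n) u.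
Proof. by rewrite /ramp_series big_ord_recr. Qed.

Lemma harmonic0 : harmonic 0 = 1 :> R.
Proof. by rewrite /harmonic/= invr1. Qed.

Section RampSum.
Variables (z x : nat -> R).
Hypothesis zx : forall k, z k < x k.

Let weight_ge0 k : 0 <= harmonic k - harmonic k.+1 :> R.
Proof. by rewrite subr_ge0 lef_pV2 ?posrE ?ltr0n// ler_nat. Qed.

(** Ramps take values in [0, 1], so an increment is at most the telescoping sum of its weights. The
    bound is uniform in [u], whence the continuity of the limit. *)
Lemma ramp_series_incr n m u : (n <= m)%N ->
  0 <= ramp_series z x m u - ramp_series z x n u <= harmonic n - harmonic m.
Proof.
move=> nm; rewrite -(subnK nm) addnC; elim: (m - n)%N => [|j IHj].
  by rewrite addn0 !subrr lexx.
rewrite addnS ramp_seriesS.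
have := weight_ge0 (n + j); have /andP[] := ramp_itv (z (n + j)%N) (x (n + j)%N) u.
move: IHj => /andP[ih1 ih2] r0 r1 w0.
have := ler_wpM2l w0 r1; have := mulr_ge0 w0 r0; rewrite mulr1.
move=> h1 h2; rewrite addrAC addr_ge0//=.
by rewrite -(subrKA (harmonic (n + j)%N) (harmonic n) (- harmonic (n + j)%N.+1)) lerD.
Qed.

Lemma ramp_sum_itv n u :
  ramp_series z x n u <= ramp_sum z x u <= ramp_series z x n u + harmonic n.
Proof.
have nd : nondecreasing_seq (ramp_series z x ^~ u).
  by move=> i j ij; have /andP[] := ramp_series_incr u ij; rewrite subr_ge0.
have ub i : ramp_series z x i u <= ramp_series z x n u + harmonic n.
  have [ni|/ltnW /nd] := leqP n i.
    have /andP[_] := ramp_series_incr u ni.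
    have := @harmonic_gt0 R i.
    lra.
  have := @harmonic_gt0 R n.
  lra.
have cv : cvgn (ramp_series z x ^~ u).
  apply: nondecreasing_is_cvgn => //.
  by exists (ramp_series z x n u + harmonic n) => _ [i _ <-].
apply/andP; split; first exact: nondecreasing_cvgn_le.
by apply: limr_le => //; exact: nearW.
Qed.

Lemma continuous_ramp_series n : continuous (ramp_series z x n).
Proof.
elim: n => [|n IHn] u.
  rewrite (_ : ramp_series z x 0 = cst 0); first exact: cst_continuous.
  by apply/funext => v; rewrite ramp_series0.
rewrite (_ : ramp_series z x n.+1 = ramp_series z x n \+
    (fun v => (harmonic n - harmonic n.+1) * ramp (z n) (x n) v)).
  apply: cvgD; first exact: IHn.
  by apply: cvgM; [exact: cvg_cst|exact: continuous_ramp].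
by apply/funext => v; rewrite ramp_seriesS.
Qed.

Lemma harmonic_lt (eps : R) : 0 < eps -> exists n, harmonic n < eps :> R.
Proof.
move=> eps0; exists (Num.trunc eps^-1).
by rewrite invf_plt ?posrE ?ltr0n// truncnS_gt.
Qed.

Lemma continuous_ramp_sum : continuous (ramp_sum z x).
Proof.
move=> u; apply/cvgrPdist_lt => eps eps0.
have eps3 : 0 < eps / 3 by rewrite divr_gt0.
have [n neps] := harmonic_lt eps3.
have /cvgrPdist_lt/(_ _ eps3) := @continuous_ramp_series n u.
apply: filterS => v; rewrite !ltr_norml => /andP[h1 h2].
have /andP[h3 h4] := ramp_sum_itv n u; have /andP[h5 h6] := ramp_sum_itv n v.
by apply/andP; split; lra.
Qed.

Lemma nondecreasing_ramp_sum : nondecreasing (ramp_sum z x).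
Proof.
move=> u v uv; rewrite -subr_le0; apply/ler_addgt0Pl => eps eps0.
have [n neps] := harmonic_lt eps0.
have /andP[_ h1] := ramp_sum_itv n u; have /andP[h2 _] := ramp_sum_itv n v.
have : ramp_series z x n u <= ramp_series z x n v.
  by apply: ler_sum => k _; rewrite ler_wpM2l// nondecreasing_ramp.
lra.
Qed.

Lemma ramp_series_ub n u : ramp_series z x n u <= 1 - harmonic n.
Proof.
have /andP[_] := ramp_series_incr u (leq0n n).
by rewrite ramp_series0 harmonic0; lra.
Qed.

Lemma ramp_sum_le1 u : ramp_sum z x u <= 1.
Proof.
have /andP[_] := ramp_sum_itv 0 u.
by rewrite ramp_series0 harmonic0 add0r.
Qed.

(** The first [m] ramps have reached 1, and their weights telescope to [1 - harmonic m]. *)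
Lemma ramp_sum_lb m u : (forall k, (k < m)%N -> x k <= u) ->
  1 - harmonic m <= ramp_sum z x u.
Proof.
move=> xu; have /andP[h _] := ramp_sum_itv m u; apply: le_trans h.
elim: m xu => [|m IHm] xu; first by rewrite ramp_series0 harmonic0 subrr.
rewrite ramp_seriesS ramp1 ?xu// mulr1.
have := IHm (fun k km => xu k (ltnW km)); lra.
Qed.

(** Only the first [m] ramps can have left 0. *)
Lemma ramp_sum_ub m u : (forall k, (m <= k)%N -> u <= z k) ->
  ramp_sum z x u <= 1 - harmonic m.
Proof.
move=> uz; have const j : ramp_series z x (m + j) u = ramp_series z x m u.
  elim: j => [|j IHj]; first by rewrite addn0.
  rewrite addnS ramp_seriesS IHj.
  by rewrite ramp0 ?mulr0 ?addr0// uz ?leq_addr.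
apply/ler_addgt0Pr => eps eps0; have [n neps] := harmonic_lt eps0.
have /andP[_ h] := ramp_sum_itv (m + n) u; rewrite (le_trans h)// const lerD//.
  exact: ramp_series_ub.
by rewrite (le_trans _ (ltW neps))// lef_pV2 ?posrE ?ltr0n// ler_nat ltnS leq_addl.
Qed.

Lemma ramp_sum_cvgNy : ramp_sum z x u @[u --> -oo] --> (0 : R).
Proof.
apply/cvgrPdist_lt => eps eps0; have [n neps] := harmonic_lt eps0.
have [M Mz] : exists M, forall k, (k < n)%N -> M <= z k.
  elim: n {neps} => [|n [M IHM]]; first by exists 0.
  exists (Num.min M (z n)) => k; rewrite ltnS leq_eqVlt => /orP[/eqP ->|/IHM].
    by rewrite ge_min lexx orbT.
  by rewrite ge_min => ->.
exists M; split=> [|u uM]; first exact: num_real.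
have /andP[h1 h2] := ramp_sum_itv n u.
have s0 : ramp_series z x n u = 0.
  rewrite /ramp_series big1// => k _.
  by rewrite ramp0 ?mulr0// (le_trans (ltW uM))// Mz.
by rewrite sub0r normrN ger0_norm; [lra|rewrite -s0].
Qed.

End RampSum.
End ContinuousApproximation.

(** * Tail equivalence and closeness of powers *)

Section TailEquivalence.
Context (R : realType).
Implicit Types (F G : R -> R).

(** The tails [1 - F] and [1 - G] have a quotient tending to 1; where [1 - G] vanishes the quotient
    has no meaning, and [1 - F] must vanish too. *)
Definition tail_equivalent F G : Prop :=
  (forall u, G u = 1 -> F u = 1) /\
  (forall eps : R, 0 < eps -> exists2 s, 0 < s & forall u, 1 - s <= G u < 1 ->
     `|F u - G u| <= eps * (1 - G u)).

(* [x k] is the quantile of [G] at level [1 - 1 / (k + 2)]; regularity allows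
   [z k < x k] with [1 - G (z k)] equivalent to [1 / (k + 2)]. *)
Lemma tail_regular_levels G : is_distr_fun G -> tail_regular G ->
  exists z x : nat -> R, [/\ forall k, z k < x k,
    forall k u, 1 - harmonic k.+1 <= G u -> x k <= u &
    forall eps : R, 0 < eps -> exists K, forall k, (K <= k)%N ->
      1 - G (z k) <= (1 + eps) * harmonic k.+1].
Proof.
move=> dG [ex1 exy]; have [ndG rcG GNy _] := dG.
(* The shift to [k.+1] makes every level at least 1/2; a positive level is what bounds [A k] from
   below. *)
pose A k := [set u | 1 - harmonic k.+1 <= G u].
have harm_lt1 k : harmonic k.+1 < 1 :> R.
  by rewrite -[ltRHS]harmonic0 /harmonic/= ltf_pV2 ?posrE ?ltr0n// ltr_nat.
have exA k : exists2 v, A k v & G v < 1.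
  have [v /andP[vA Gv]] := ex1 _ (@harmonic_gt0 R k.+1).
  by exists v => //; exact: ltW.
have lbA k : has_lbound (A k).
  have : 0 < 1 - harmonic k.+1 :> R by rewrite subr_gt0.
  have /cvgrPdist_lt := GNy => /[apply] -[M [_ MG]].
  exists M => u uA; rewrite leNgt; apply/negP => /MG.
  by rewrite sub0r normrN; apply/negP; rewrite -leNgt (le_trans uA)// ler_norm.
have infA k : has_inf (A k) by split=> //; have [v] := exA k; exists v.
pose x k := inf (A k).
have x_le k u : A k u -> x k <= u by exact: ge_inf.
(* Right continuity makes the infimum a point of [A k]. *)
have Gx k : 1 - harmonic k.+1 <= G (x k).
  apply: (cvgr_to_ge (rcG (x k))); near=> u.
  have xu : x k < u by near: u; exact: nbhs_right_gt.
  have [v Av vu] := inf_lt (infA k).1 xu.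
  exact/(le_trans Av)/ndG/ltW.
have Gx1 k : G (x k) < 1.
  by have [v /x_le/ndG xv] := exA k; exact: le_lt_trans.
(* The slack is quadratic so as to be negligible against [harmonic k.+1]: one choice of [z k] then
   serves every [eps]. *)
have /choice[z zP] : forall k, exists z,
    z < x k /\ left_lim G (x k) - harmonic k.+1 ^+ 2 < G z.
  move=> k; have [|z zx Gz] := @lt_left_lim R G ndG (x k)
    (left_lim G (x k) - harmonic k.+1 ^+ 2); last by exists z.
  by rewrite ltrBlDr ltrDl exprn_gt0// harmonic_gt0.
exists z, x; split=> [k|k u|eps eps0]; [by have [] := zP k|exact: x_le|].
have eps20 : 0 < eps / 2 by rewrite divr_gt0.
have [s s0 sG] := exy _ eps20.
have [|K Kmin] := @harmonic_lt R (Num.min s (eps / 2)).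
  by rewrite lt_min s0.
exists K => k Kk; have h0 := @harmonic_gt0 R k.+1.
have hK : harmonic k.+1 <= harmonic K :> R.
  by rewrite /harmonic/= lef_pV2 ?posrE ?ltr0n// ler_nat ltnS (leq_trans Kk).
move: Kmin; rewrite lt_min => /andP[Ks Keps].
have [|y yx Gy] := sG (x k).
  by rewrite Gx1 andbT (le_trans _ (Gx k))//; lra.
have [_ Gz] := zP k; have lG := le_left_lim ndG yx; have Gxk := Gx k.
have : (1 + eps / 2) * (1 - G (x k)) <= (1 + eps / 2) * harmonic k.+1.
  by rewrite ler_pM2l; lra.
have : harmonic k.+1 ^+ 2 <= harmonic k.+1 * (eps / 2) :> R.
  by rewrite expr2 ler_pM2l//; lra.
lra.
Unshelve. all: by end_near. Qed.

Lemma truncn_div_itv (a t : R) : 0 <= a -> 0 < t ->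
  (Num.trunc (a / t))%:R * t <= a < (Num.trunc (a / t)).+1%:R * t.
Proof.
move=> a0 t0; have /truncn_itv : 0 <= a / t by rewrite divr_ge0// ltW.
by rewrite ler_pdivlMr// ltr_pdivrMr.
Qed.

Lemma harmonic_le k (c : R) : (harmonic k <= c) = (1 <= c * k.+1%:R).
Proof. by rewrite /harmonic/= -div1r ler_pdivrMr// ltr0n. Qed.

Lemma le_harmonic k (c : R) : (c <= harmonic k) = (c * k.+1%:R <= 1).
Proof. by rewrite /harmonic/= -div1r ler_pdivlMr// ltr0n. Qed.

(** Where [1 - G u = t], the ramps of index below about [1 / t] are complete and those of index
    above about [(1 + eps / 2) / t] have not begun. Hence [ramp_sum_lb] and [ramp_sum_ub] pin
    [1 - ramp_sum z x u] to [t], up to a factor within [eps] of 1. *)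
Lemma tail_equivalent_ramp_sum G (z x : nat -> R) :
  nondecreasing G -> (forall k, z k < x k) ->
  (forall k u, 1 - harmonic k.+1 <= G u -> x k <= u) ->
  (forall eps : R, 0 < eps -> exists K, forall k, (K <= k)%N ->
    1 - G (z k) <= (1 + eps) * harmonic k.+1) ->
  tail_equivalent (ramp_sum z x) G.
Proof.
move=> ndG zx Gx Gz; split=> [u Gu|].
  apply/eqP; rewrite eq_le ramp_sum_le1//=.
  apply/ler_addgt0Pr => eps eps0; have [n neps] := harmonic_lt eps0.
  have : 1 - harmonic n <= ramp_sum z x u.
    apply: ramp_sum_lb => // k _; apply: Gx.
    by rewrite Gu lerBlDr lerDl harmonic_ge0.
  lra.
move=> eps; wlog eps1 : eps / eps < 1.
  move=> H eps0; have [/H|eps1] := ltP eps 1; first exact.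
  have [||s s0 sG] := H (1 / 2); [lra|lra|].
  exists s => // u su; rewrite (le_trans (sG u su))//.
  by have /andP[_ ?] := su; rewrite ler_pM2r ?subr_gt0//; lra.
move=> eps0; have [|K Kz] := Gz (eps / 2); first by rewrite divr_gt0.
have hK0 := @harmonic_gt0 R K.
(* Rounding the index to an integer costs a relative error of order [t], absorbed by [t <= eps / 2];
   [t <= harmonic K] puts the index [M] of the upper bound past [K], where [Kz] applies. *)
exists (Num.min (eps / 2) (harmonic K)); first by rewrite lt_min hK0 divr_gt0.
move=> u /andP[us u1]; have t0 : 0 < 1 - G u by rewrite subr_gt0.
have : 1 - G u <= Num.min (eps / 2) (harmonic K) by lra.
rewrite le_min; set t := 1 - G u in t0 * => /andP[teps tK].
have t1 : t < 1 by lra.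
have lower : 1 - (1 + eps) * t <= ramp_sum z x u.
  have := truncn_div_itv ler01 t0.
  case: (Num.trunc _) => [|N] /andP[Nt tN]; first by move: tN; rewrite mul1r; lra.
  have : 1 - harmonic N <= ramp_sum z x u.
    apply: ramp_sum_lb => // k kN; apply: Gx.
    suff : t <= harmonic k.+1 by rewrite /t; lra.
    rewrite le_harmonic (le_trans _ Nt)// mulrC ler_pM2r// ler_nat ltnS//.
  apply: le_trans; rewrite lerD2l lerN2 harmonic_le.
  move: tN; rewrite -(natr1 N.+1); set n := N.+1%:R in Nt * => tN.
  have : (1 + eps) * (1 - t) <= (1 + eps) * (t * n) by rewrite ler_pM2l; lra.
  rewrite mulrA; have : eps * t <= eps * (1 / 2) by rewrite ler_pM2l; lra.
  lra.
have upper : ramp_sum z x u <= 1 - (1 - eps) * t.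
  have eps20 : 0 <= 1 + eps / 2 by lra.
  have /andP[] := truncn_div_itv eps20 t0; set M := Num.trunc _ => Mt tM.
  have KM : (K <= M)%N.
    rewrite leqNgt; apply/negP => MK; move: tK; rewrite le_harmonic => tK.
    have : M.+1%:R * t <= K.+1%:R * t by rewrite ler_pM2r// ler_nat ltnS ltnW.
    by rewrite mulrC in tK; lra.
  have : ramp_sum z x u <= 1 - harmonic M.
    apply: ramp_sum_ub => // k Mk; apply/ltW/(nondecreasing_lt ndG).
    suff : 1 - G (z k) < t by rewrite /t; lra.
    apply: (le_lt_trans (Kz k (leq_trans KM Mk))).
    rewrite /harmonic/= ltr_pdivrMr ?ltr0n// (lt_le_trans tM)// mulrC.
    by rewrite ler_pM2l// ler_nat ltnS (leq_trans Mk).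
  move=> /le_trans; apply; rewrite lerD2l lerN2 le_harmonic -mulrA (mulrC t).
  move: tM; rewrite -(natr1 M) mulrDl mul1r => tM.
  have : (1 - eps) * (M%:R * t + t) <= (1 - eps) * (1 + eps).
    by rewrite ler_pM2l; lra.
  by have := sqr_ge0 eps; rewrite expr2; lra.
rewrite ler_norml /t in lower upper *; apply/andP; split; lra.
Qed.

Lemma normXB_le (p q h : R) n : 0 <= p -> p <= h -> 0 <= q -> q <= h ->
  `|p ^+ n.+1 - q ^+ n.+1| <= n.+1%:R * `|p - q| * h ^+ n.
Proof.
wlog pq : p q / p <= q.
  move=> H p0 ph q0 qh; have [/H|/ltW qp] := leP p q; first exact.
  by rewrite distrC (distrC p); exact: H.
move=> p0 ph q0 qh; have /andP[_ subr] := subX_itv n p0 pq.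
rewrite distrC (distrC p) !ger0_norm ?subr_ge0 ?lerXn2r ?nnegrE//.
apply: (le_trans subr); rewrite ler_wpM2l ?mulr_ge0 ?subr_ge0//.
by rewrite lerXn2r ?nnegrE// (le_trans q0).
Qed.

(** Away from the right end both powers are at most [rho ^+ n] with [rho < 1]. Near it, with
    [t = 1 - G u], both functions are at most [1 - t / 2], so the powers differ by at most
    [n * (e * t) * (1 - t / 2) ^+ n.-1]. By [subX_itv] with [q = 1],
    [n * (t / 2) * (1 - t / 2) ^+ n.-1 <= 1], which leaves [2 * e], independent of [n] and [t]. *)
Lemma tail_equivalent_close_powers F G :
  nondecreasing F -> (forall u, 0 <= F u <= 1) ->
  nondecreasing G -> (forall u, 0 <= G u <= 1) ->
  (forall s, 0 < s -> exists x, 1 - s < G x < 1) ->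
  tail_equivalent F G -> close_powers F G.
Proof.
move=> ndF F01 ndG G01 exG [FG1 FG] eps eps0.
have e0 : 0 < Num.min (eps / 2) (1 / 2) by rewrite lt_min; lra.
have [s s0 sFG] := FG _ e0; set e := Num.min _ _ in e0 sFG.
have eeps : e <= eps / 2 by rewrite ge_min lexx.
have e2 : e <= 1 / 2 by rewrite ge_min lexx orbT.
have [v /andP[sv Gv]] := exG _ s0.
have Fv : F v < 1.
  have := sFG v; rewrite (ltW sv) Gv => /(_ isT); rewrite ler_norml => /andP[_].
  have : e * (1 - G v) <= 1 / 2 * (1 - G v) by rewrite ler_pM2r ?subr_gt0.
  lra.
set rho := Num.max (F v) (G v).
have rho0 : 0 <= rho by rewrite le_max; have /andP[-> _] := F01 v.
have rho1 : rho < 1 by rewrite gt_max Fv.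
near=> n => u; have /andP[F0 F1] := F01 u; have /andP[G0 G1] := G01 u.
have [Gu|Gu] := eqVneq (G u) 1; first by rewrite Gu FG1// subrr normr0 ltW.
have {Gu} Gu : G u < 1 by rewrite lt_neqAle Gu.
have [Gus|Gus] := ltP (G u) (1 - s).
  have uv : u <= v by apply/ltW/(nondecreasing_lt ndG)/(lt_trans Gus).
  have rhon : rho ^+ n <= eps by near: n; exact: near_exprn_le.
  have Frho : F u ^+ n <= rho ^+ n.
    by rewrite lerXn2r ?nnegrE// le_max ndF.
  have Grho : G u ^+ n <= rho ^+ n.
    by rewrite lerXn2r ?nnegrE// le_max ndG ?orbT.
  have := exprn_ge0 n F0; have := exprn_ge0 n G0.
  by rewrite ler_norml => ? ?; apply/andP; split; lra.
have n0 : (0 < n)%N by near: n; exact: nbhs_infty_gt.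
have /sFG : 1 - s <= G u < 1 by rewrite Gus.
set t := 1 - G u => FGt; have t0 : 0 < t by rewrite subr_gt0.
have et : e * t <= 1 / 2 * t by rewrite ler_pM2r.
have h0 : 0 <= 1 - t / 2 by rewrite /t; lra.
have h1 : 1 - t / 2 <= 1 by lra.
have Fh : F u <= 1 - t / 2.
  by move: FGt et; rewrite ler_norml /t => /andP[_] *; lra.
have Gh : G u <= 1 - t / 2 by rewrite /t; lra.
rewrite -(prednK n0); apply: (le_trans (normXB_le _ F0 Fh G0 Gh)).
have /andP[+ _] := subX_itv n.-1 h0 h1.
rewrite expr1n opprB addrC subrK; set c := n.-1.+1%:R; set hn := (1 - t / 2) ^+ _.
have c0 : 0 <= c by rewrite ler0n.
have hn0 : 0 <= hn by rewrite exprn_ge0.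
have := exprn_ge0 n.-1.+1 h0 => hn1 ch.
apply: (@le_trans _ _ (2 * e * (c * (t / 2) * hn))).
  rewrite (_ : 2 * e * _ = c * (e * t) * hn); last by field.
  by rewrite ler_wpM2r// ler_wpM2l.
apply: (@le_trans _ _ (2 * e)); last lra.
by rewrite ler_piMr; lra.
Unshelve. all: by end_near. Qed.

Lemma tail_regular_continuous G : is_distr_fun G -> tail_regular G ->
  exists F, [/\ continuous F, is_distr_fun F & close_powers F G].
Proof.
move=> dG tG; have [ndG rcG GNy Gy] := dG.
have [z [x [zx xG Gz]]] := tail_regular_levels dG tG.
have cF : continuous (ramp_sum z x) by exact: continuous_ramp_sum.
have ndF : nondecreasing (ramp_sum z x) by exact: nondecreasing_ramp_sum.
have F1 u : ramp_sum z x u <= 1 by exact: ramp_sum_le1.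
have Fy : ramp_sum z x u @[u --> +oo] --> (1 : R).
  apply/cvgrPdist_lt => eps eps0; have [n neps] := harmonic_lt eps0.
  have /cvgrPdist_lt := Gy => /(_ _ (@harmonic_gt0 R n.+1))[M [_ MG]].
  exists M; split=> [|u /MG Gu]; first exact: num_real.
  have : 1 - harmonic n <= ramp_sum z x u.
    apply: ramp_sum_lb => // k kn; apply: xG.
    have : harmonic n.+1 <= harmonic k.+1 :> R.
      by rewrite /harmonic/= lef_pV2 ?posrE ?ltr0n// ler_nat !ltnS ltnW.
    by have := ler_norm (1 - G u); lra.
  by rewrite ger0_norm ?subr_ge0//; lra.
have dF : is_distr_fun (ramp_sum z x).
  split=> //; last exact: ramp_sum_cvgNy.
  by move=> u; apply: cvg_at_right_filter; exact: cF.
exists (ramp_sum z x); split=> //.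
apply: tail_equivalent_close_powers => //.
- by move=> u; exact: distr_fun_itv.
- by move=> u; exact: distr_fun_itv.
- by have [] := tG.
- exact: tail_equivalent_ramp_sum.
Qed.

End TailEquivalence.

(** * Real powers of distribution functions *)

Section RealPowers.
Context (R : realType).
Implicit Types (F G : R -> R) (a b x : R).

(** With [y = x^a], the inequality [1 - exp(- s) <= s] bounds the difference by [(b - a) / a] times
    [- y ln y], and [- y ln y <= 1] removes [x]. *)
Lemma powR_exponent_close a b x : 0 < a -> a <= b -> 0 <= x <= 1 ->
  `|x `^ a - x `^ b| <= (b - a) / a.
Proof.
move=> a0 ab /andP[x0 x1]; have b0 := lt_le_trans a0 ab.
have ba : 0 <= b - a by rewrite subr_ge0.
have [->|xn0] := eqVneq x 0.
  by rewrite !powR0 ?gt_eqF// subrr normr0 divr_ge0// ltW.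
have {xn0} x0 : 0 < x by rewrite lt_neqAle eq_sym xn0.
set y := x `^ a; have y0 : 0 < y by rewrite powR_gt0.
have lnx : ln x <= 0 by rewrite ln_le0.
have -> : x `^ b = y * expR ((b - a) * ln x).
  rewrite -[in LHS](subrKC a b) powRD; last by rewrite (gt_eqF x0) implybT.
  by rewrite /y /powR (gt_eqF x0).
have e1 : expR ((b - a) * ln x) <= 1 by rewrite -expR0 ler_expR mulr_ge0_le0.
have e2 := expR_ge1Dx ((b - a) * ln x).
have yl : y * (- (a * ln x)) <= 1.
  have := expR_ge1Dx (- (a * ln x)).
  have -> : expR (- (a * ln x)) = y^-1 by rewrite expRN /y /powR (gt_eqF x0).
  by move=> h; rewrite mulrC -ler_pdivlMr// div1r; lra.
rewrite -[X in X - _]mulr1 -mulrBr ger0_norm; last first.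
  by rewrite mulr_ge0 ?subr_ge0// ltW.
rewrite ler_pdivlMr//.
have : y * (1 - expR ((b - a) * ln x)) <= y * (- ((b - a) * ln x)).
  by rewrite ler_pM2l//; lra.
move=> /(ler_wpM2r (ltW a0)) /le_trans; apply.
rewrite (_ : _ * _ * a = (b - a) * (y * - (a * ln x))); last by ring.
by rewrite ler_piMr.
Qed.

(* [powR] takes the value [1] on negative bases, hence the truncation. *)
Lemma continuous_powR_max a : 0 < a -> continuous (fun x => Num.max 0 x `^ a).
Proof.
move=> a0 x; have [x0|x0|->] := ltgtP x 0.
- apply/cvgrPdist_le => eps eps0; near=> y.
  rewrite !max_l ?subrr ?normr0 ?ltW//; near: y; exact: lt_nbhsl.
- have : {for x, continuous (fun y : R => y `^ a)}.
    apply: differentiable_continuous; apply/derivable1_diffP.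
    by apply: derivable_powR; rewrite in_itv/= x0.
  rewrite /prop_for/continuous_at max_r ?(ltW x0)//; apply: cvg_trans.
  apply: near_eq_cvg; near=> y; rewrite max_r// ltW//.
  by near: y; exact: lt_nbhsr.
- apply/cvgrPdist_le => eps eps0; near=> y.
  rewrite max_l// powR0 ?gt_eqF// sub0r normrN ger0_norm ?powR_ge0//.
  rewrite -[leRHS](powRr1 (ltW eps0)) -(mulVf (lt0r_neq0 a0)).
  rewrite powRrM ge0_ler_powR ?nnegrE ?powR_ge0 ?(ltW a0)//.
    by rewrite le_max lexx.
  rewrite ge_max powR_ge0/= ltW//; near: y; apply: lt_nbhsl.
  by rewrite powR_gt0.
Unshelve. all: by end_near. Qed.

Lemma distr_fun_powR G a : 0 < a -> is_distr_fun G ->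
  is_distr_fun (fun x => G x `^ a).
Proof.
move=> a0 dG; have [ndG rcG GNy Gy] := dG.
have G0 x : 0 <= G x by have /andP[] := distr_fun_itv x dG.
have -> : (fun x => G x `^ a) = (fun x => Num.max 0 x `^ a) \o G.
  by apply/funext => x /=; rewrite max_r.
have cp := continuous_powR_max a0.
split.
- by move=> x y xy /=; rewrite !max_r// ge0_ler_powR ?nnegrE ?(ltW a0)// ndG.
- by move=> x; apply: cvg_comp; [exact: rcG|exact: cp].
- rewrite [X in _ --> X](_ : 0 = Num.max 0 0 `^ a); last first.
    by rewrite maxxx powR0// gt_eqF.
  exact: (cvg_comp _ _ GNy (cp 0)).
- rewrite [X in _ --> X](_ : 1 = Num.max 0 1 `^ a); last first.
    by rewrite max_r// powR1.
  exact: (cvg_comp _ _ Gy (cp 1)).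
Qed.

Lemma continuous_distr_fun_powR F a : 0 < a -> continuous F ->
  is_distr_fun F -> continuous (fun x => F x `^ a).
Proof.
move=> a0 cF dF; have cp := continuous_powR_max a0.
have -> : (fun x => F x `^ a) = (fun x => Num.max 0 x `^ a) \o F.
  by apply/funext => x /=; rewrite max_r//; have /andP[] := distr_fun_itv x dF.
by move=> x; apply: continuous_comp; [exact: cF|exact: cp].
Qed.

(** [(F^a)^n] is [F^(a n)]; replacing [a n] by its integer part [m] costs at most [1 / m] by
    [powR_exponent_close], and closeness is available at [m]. *)
Lemma close_powers_powR F G a : 0 < a ->
  (forall u, 0 <= F u <= 1) -> (forall u, 0 <= G u <= 1) ->
  close_powers F G -> close_powers (fun u => F u `^ a) (fun u => G u `^ a).
Proof.
move=> a0 F01 G01 FG eps eps0.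
have eps3 : 0 < eps / 3 by rewrite divr_gt0.
have [N _ FGN] := FG _ eps3.
pose M := maxn N (Num.trunc (eps / 3)^-1).+1.
exists (Num.trunc (M.+1%:R / a)).+1 => // n /= Mn u.
have Man : M.+1%:R <= a * n%:R.
  by rewrite mulrC -ler_pdivrMr// (le_trans (ltW (truncnS_gt _)))// ler_nat.
have an0 : 0 <= a * n%:R by rewrite mulr_ge0// ltW.
have /andP[] := truncn_itv an0; set m := Num.trunc _ => mn nm.
have Mm : (M <= m)%N.
  by rewrite -ltnS -(ltr_nat R) (le_lt_trans _ nm)// (le_trans _ Man)// ler_nat.
have m0 : 0 < m%:R :> R by rewrite ltr0n (leq_trans _ Mm)// leq_max ltn0Sn orbT.
have meps : (a * n%:R - m%:R) / m%:R <= eps / 3.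
  rewrite ler_pdivrMr// (@le_trans _ _ 1)//; first by rewrite -natr1 in nm; lra.
  rewrite -ler_pdivrMl// mulr1 (le_trans (ltW (truncnS_gt _)))// ler_nat.
  by rewrite (leq_trans _ Mm)// leq_max leqnn orbT.
have powm (H : R -> R) : (forall u, 0 <= H u <= 1) ->
    `|H u ^+ m - (H u `^ a) ^+ n| <= eps / 3.
  move=> H01; have /andP[H0 _] := H01 u.
  rewrite -powR_mulrn// -[X in _ - X]powR_mulrn ?powR_ge0// -powRrM.
  exact: le_trans (powR_exponent_close m0 mn (H01 u)) meps.
have := powm F F01; have := powm G G01.
have := FGN m (leq_trans (leq_maxl _ _) Mm) u.
rewrite !ler_norml => /andP[h1 h2] /andP[h3 h4] /andP[h5 h6].
by apply/andP; split; lra.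
Qed.

End RealPowers.

(** * The weak law of large numbers *)

Section IntegerValuedVariables.
Context (d : measure_display) (T : measurableType d) (R : realType)
  (P : probability T R).
Local Open Scope ereal_scope.

Lemma measurable_fun_nat (W : T -> nat) (g : nat -> R) :
  measurable_fun setT W -> measurable_fun setT (fun w => g (W w)).
Proof.
move=> mW; apply: (@measurableT_comp _ _ _ _ _ _ g) => //.
Qed.

Section IndependentProduct.
Variables (W : nat -> T -> nat) (g : nat -> R).
Hypothesis mW : forall i, measurable_fun setT (W i).
Hypothesis g0 : forall m, (0 <= g m)%R.
Hypothesis g1 : forall m, (g m <= 1)%R.

(** [D] records the values of variables already integrated out; for [D] the whole space this is
    independence of the first [j] variables. *)
Definition indep_upto (j : nat) (D : set T) : Prop :=
  forall B : nat -> set nat,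
    P ((\bigcap_(i in `I_j) W i @^-1` B i) `&` D) =
    (\prod_(i < j) P (W i @^-1` B i)) * P D.

Let measurable_preimage i (A : set nat) : measurable (W i @^-1` A).
Proof. by rewrite -[X in measurable X]setTI; exact: mW. Qed.

(** Constraining the last variable to [m] gives [key]; leaving all the others free in [key] gives
    the probability of the slice. *)
Lemma indep_upto_slice j D m : indep_upto j.+1 D ->
  P (W j @^-1` [set m] `&` D) = P (W j @^-1` [set m]) * P D /\
  indep_upto j (W j @^-1` [set m] `&` D).
Proof.
move=> iD.
have key B : P ((\bigcap_(i in `I_j) W i @^-1` B i) `&`
      (W j @^-1` [set m] `&` D)) =
    (\prod_(i < j) P (W i @^-1` B i)) * (P (W j @^-1` [set m]) * P D).
  have := iD (fun i => if (i < j)%N then B i else [set m]).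
  rewrite big_ord_recr/= ltnn -muleA.
  under eq_bigr do rewrite ltn_ord.
  move=> <-; congr (P _); rewrite setIA; congr (_ `&` _).
  apply/seteqP; split=> w /=.
    move=> [Bw Wj] i /=; rewrite ltnS leq_eqVlt => /orP[/eqP ->|ij].
      by rewrite ltnn.
    by rewrite ij; exact: Bw.
  move=> Bw; split=> [i /= ij|].
    by have /= := Bw i (ltnW ij : (i < j.+1)%N); rewrite ij.
  by have /= := Bw j (ltnSn j); rewrite ltnn.
have step : P (W j @^-1` [set m] `&` D) = P (W j @^-1` [set m]) * P D.
  have := key (fun=> setT).
  rewrite (_ : \bigcap_(i in `I_j) _ = setT) ?setTI; last exact/seteqP.
  move=> ->.
  by rewrite big1 ?mul1e// => i _; rewrite preimage_setT probability_setT.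
by split=> // B; rewrite key step.
Qed.

Lemma measurable_prod_nat j :
  measurable_fun setT (fun w => \prod_(i < j) g (W i w))%R.
Proof.
by apply: measurable_prod => i _; exact: measurable_fun_nat.
Qed.

Lemma prod_nat_ge0 j w : (0 <= \prod_(i < j) g (W i w))%R.
Proof. exact: prodr_ge0. Qed.

Lemma integral_slices j (D : set T) (h : T -> \bar R) : measurable D ->
  measurable_fun [set: T] h -> (forall w, 0 <= h w) ->
  \int[P]_(w in D) h w =
  \sum_(m <oo) \int[P]_(w in W j @^-1` [set m] `&` D) h w.
Proof.
move=> mD mh h0.
have {1}-> : D = \bigcup_m (W j @^-1` [set m] `&` D).
  rewrite -setI_bigcupl; apply/seteqP; split=> w /=; last by case.
  by move=> Dw; split=> //; exists (W j w).
apply: ge0_integral_bigcup => //.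
- by move=> m; exact: measurableI.
- exact: measurable_funTS.
- apply/trivIsetP => m n _ _ mn; apply/seteqP; split=> // w [[/= e1 _] [/= e2 _]].
  by move: mn; rewrite -e1 -e2 eqxx.
Qed.

Lemma integral_nat_fin_num i : \int[P]_w (g (W i w))%:E \is a fin_num.
Proof.
rewrite ge0_fin_numE; last by apply: integral_ge0 => w _; rewrite lee_fin.
apply: (@le_lt_trans _ _ (\int[P]_w (cst 1 w))); last first.
  rewrite integral_cst// mul1e. by rewrite -ge0_fin_numE// fin_num_measure.
apply: ge0_le_integral => //.
- by move=> w _; rewrite lee_fin.
- by apply/measurable_EFinP; exact: measurable_fun_nat.
- by move=> w _; rewrite lee_fin.
Qed.

(* Slicing [D] along the values of the last variable preserves independence from
   the remaining ones, so the factors can be integrated out one at a time. *)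
Lemma indep_prod_integral j D : measurable D -> indep_upto j D ->
  \int[P]_(w in D) (\prod_(i < j) g (W i w))%:E =
  (\prod_(i < j) \int[P]_w (g (W i w))%:E) * P D.
Proof.
elim: j D => [|j IHj] D mD iD.
  under eq_integral do rewrite big_ord0.
  by rewrite big_ord0 integral_cst.
have mprod k : measurable_fun setT (fun w => (\prod_(i < k) g (W i w))%:E).
  by apply/measurable_EFinP; exact: measurable_prod_nat.
rewrite (integral_slices j)//; last by move=> w; rewrite lee_fin prod_nat_ge0.
have slice m : \int[P]_(w in W j @^-1` [set m] `&` D)
      (\prod_(i < j.+1) g (W i w))%:E =
    (\prod_(i < j) \int[P]_w (g (W i w))%:E) * P D *
      ((g m)%:E * P (W j @^-1` [set m])).
  have [Pm iDm] := indep_upto_slice m iD.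
  have mDm : measurable (W j @^-1` [set m] `&` D) by exact: measurableI.
  transitivity (\int[P]_(w in W j @^-1` [set m] `&` D)
      ((g m)%:E * (\prod_(i < j) g (W i w))%:E)).
    apply: eq_integral => w; rewrite inE => -[/= Wj _].
    by rewrite big_ord_recr/= Wj -EFinM mulrC.
  rewrite ge0_integralZl//; last 3 first.
  - exact: measurable_funTS.
  - by move=> w _; rewrite lee_fin prod_nat_ge0.
  - by rewrite lee_fin.
  by rewrite IHj// Pm muleCA -!muleA (muleC (P D)) !muleA.
under eq_eseriesr do rewrite slice.
have c_fin : (\prod_(i < j) \int[P]_w (g (W i w))%:E) * P D \is a fin_num.
  rewrite fin_numM ?fin_num_measure//.
  apply: (big_ind (fun x => x \is a fin_num)) => // [|i _]; first exact: fin_numM.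
  exact: integral_nat_fin_num.
rewrite -(fineK c_fin) nneseriesZl; last by move=> m _; rewrite mule_ge0 ?lee_fin.
rewrite fineK//.
rewrite big_ord_recr/= muleAC; congr (_ * _ * _).
rewrite (@integral_slices j setT)//.
- apply: eq_eseriesr => m _; rewrite setIT.
  transitivity (\int[P]_(w in W j @^-1` [set m]) cst (g m)%:E w).
    by rewrite integral_cst.
 
  by apply: eq_integral => w; rewrite inE => /= ->.
- by apply/measurable_EFinP; exact: measurable_fun_nat.
- by move=> w; rewrite lee_fin.
Qed.

End IndependentProduct.
End IntegerValuedVariables.

(** * Exponential limits and Laplace transforms *)

Section ExponentialLimits.
Context (R : realType).

(** The lower bound uses [exp(- y) <= 1 / (1 + y)] and the factorization of [1 + y ^+ 3]. *)
Lemma expRN_bounds (y : R) : 0 <= y -> y - y ^+ 2 <= 1 - expR (- y) <= y.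
Proof.
move=> y0; apply/andP; split; last by have := expR_ge1Dx (- y); lra.
have y1 : 0 < 1 + y by lra.
have : expR (- y) <= (1 + y)^-1.
  by rewrite expRN lef_pV2 ?posrE ?expR_gt0// expR_ge1Dx.
suff : (1 + y)^-1 <= 1 - y + y ^+ 2 by lra.
rewrite -div1r ler_pdivrMr// (_ : _ * _ = 1 + y ^+ 3); last by ring.
by rewrite lerDl exprn_ge0.
Qed.

(** For [y = 1 - p k], squeeze [p k] between [exp(- y / (1 - y))] and [exp(- y)] and take powers. *)
Lemma cvg_exprn_expRN (p : nat -> R) (c : R) : (forall k, p k <= 1) ->
  k.+1%:R * (1 - p k) @[k --> \oo] --> c ->
  p k ^+ k.+1 @[k --> \oo] --> expR (- c).
Proof.
move=> p1 pc.
have y0 : 1 - p k @[k --> \oo] --> (0 : R).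
  rewrite -[X in _ --> X](mulr0 c); under eq_fun => k.
    rewrite -[1 - p k](mulKf (lt0r_neq0 (ltr0Sn R k))) mulrC; over.
  by apply: cvgM => //; exact: cvg_harmonic.
have upper : expR (- (k.+1%:R * (1 - p k))) @[k --> \oo] --> expR (- c).
  by apply: continuous_cvg; [exact: continuous_expR|exact: cvgN].
have lower : expR (- (k.+1%:R * (1 - p k) / (1 - (1 - p k)))) @[k --> \oo] -->
    expR (- c).
  apply: continuous_cvg; first exact: continuous_expR.
  apply: cvgN; rewrite [X in _ --> X](_ : c = c * 1^-1); last first.
    by rewrite invr1 mulr1.
  apply: cvgM => //; apply: cvgV; first exact: oner_neq0.
  by rewrite -[X in _ --> X]subr0; apply: cvgB => //; exact: cvg_cst.
apply: squeeze_cvgr lower upper; near=> k.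
have y1 : 1 - p k < 1.
  near: k; have /cvgrPdist_lt/(_ _ ltr01) := y0.
  by apply: filterS => k; rewrite sub0r normrN; exact/le_lt_trans/ler_norm.
have pk0 : 0 < p k by lra.
have expRX z : expR (- (k.+1%:R * z)) = expR (- z) ^+ k.+1.
  by rewrite -mulrN expRM_natl.
rewrite subKr -mulrA !expRX; apply/andP; split.
- rewrite lerXn2r ?nnegrE ?expR_ge0 ?(ltW pk0)// expRN.
  rewrite invf_ple ?posrE ?expR_gt0//.
  have := expR_ge1Dx ((1 - p k) / p k); apply: le_trans.
  by rewrite mulrBl mul1r divff ?gt_eqF// addrC subrK.
- rewrite lerXn2r ?nnegrE ?expR_ge0 ?(ltW pk0)//.
  by have := expR_ge1Dx (- (1 - p k)); lra.
Unshelve. all: by end_near. Qed.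

Lemma cvg_expRN_scaled (z : R) : 0 <= z ->
  k.+1%:R * (1 - expR (- (z * harmonic k))) @[k --> \oo] --> z.
Proof.
move=> z0; have lower : z - z ^+ 2 * harmonic k @[k --> \oo] --> z.
  rewrite -[X in _ --> X]subr0; apply: cvgB; first exact: cvg_cst.
  rewrite -[X in _ --> X](mulr0 (z ^+ 2)).
  by apply: cvgM; [exact: cvg_cst|exact: cvg_harmonic].
apply: squeeze_cvgr lower (cvg_cst z); near=> k.
have k0 : 0 < k.+1%:R :> R by rewrite ltr0n.
have hk : k.+1%:R * harmonic k = 1 :> R by rewrite /harmonic/= divff ?gt_eqF.
have /andP[l u] := expRN_bounds (mulr_ge0 z0 (@harmonic_ge0 R k)).
have := ler_wpM2l (ltW k0) u; have := ler_wpM2l (ltW k0) l.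
rewrite (_ : k.+1%:R * (z * harmonic k - (z * harmonic k) ^+ 2) =
  (k.+1%:R * harmonic k) * (z - z ^+ 2 * harmonic k)); last by ring.
rewrite (_ : k.+1%:R * (z * harmonic k) = k.+1%:R * harmonic k * z); last by ring.
by rewrite hk !mul1r => -> ->.
Unshelve. all: by end_near. Qed.

End ExponentialLimits.

Section LaplaceTransform.
Context (d : measure_display) (T : measurableType d) (R : realType)
  (P : probability T R).
Implicit Types (V : T -> nat) (s t : R).

Let expRN_le1 s m : 0 <= s -> expR (- (s * m%:R)) <= 1.
Proof. by move=> s0; rewrite -expR0 ler_expR oppr_le0 mulr_ge0. Qed.

Let measurable_laplace V s : measurable_fun [set: T] V ->
  measurable_fun [set: T] (fun w => (expR (- (s * (V w)%:R)))%:E).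
Proof.
move=> mV; apply/measurable_EFinP.
exact: (@measurable_fun_nat _ _ _ V (fun m => expR (- (s * m%:R)))).
Qed.

Lemma integral_probability1 : (\int[P]_w 1 = 1)%E.
Proof. by rewrite integral_cst//= mul1e probability_setT. Qed.

Definition laplace V s : R := fine (\int[P]_w (expR (- (s * (V w)%:R)))%:E).

Lemma laplaceE V s : measurable_fun [set: T] V -> 0 <= s ->
  (\int[P]_w (expR (- (s * (V w)%:R)))%:E)%E = (laplace V s)%:E.
Proof.
move=> mV s0; rewrite fineK//.
apply: (@integral_nat_fin_num _ _ _ P (fun=> V) (fun m => expR (- (s * m%:R)))
  _ _ _ 0%N) => // m; exact: expRN_le1.
Qed.

Lemma integral_subr_laplace V s : measurable_fun [set: T] V -> 0 <= s ->
  (\int[P]_w (1 - expR (- (s * (V w)%:R)))%:E)%E = (1 - laplace V s)%:E.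
Proof.
move=> mV s0.
have : (\int[P]_w ((1 - expR (- (s * (V w)%:R)))%:E +
    (expR (- (s * (V w)%:R)))%:E) = 1)%E.
  under eq_integral do rewrite -EFinD subrK.
  by rewrite integral_probability1.
rewrite ge0_integralD//; last 3 first.
- by move=> w _; rewrite lee_fin subr_ge0 expRN_le1.
- apply/measurable_EFinP.
  exact: (@measurable_fun_nat _ _ _ V (fun m => 1 - expR (- (s * m%:R)))).
- exact: measurable_laplace.
rewrite laplaceE// => /(congr1 (fun x => x - (laplace V s)%:E)%E).
by rewrite addeK// => ->.
Qed.

Lemma laplace_le1 V s : measurable_fun [set: T] V -> 0 <= s -> laplace V s <= 1.
Proof.
move=> mV s0; rewrite -subr_ge0 -lee_fin -integral_subr_laplace//.
by apply: integral_ge0 => w _; rewrite lee_fin subr_ge0 expRN_le1.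
Qed.

Lemma cvg_laplace1 V t : measurable_fun [set: T] V -> 0 <= t ->
  laplace V (t * harmonic k) @[k --> \oo] --> (1 : R).
Proof.
move=> mV t0; have tk0 k : 0 <= t * harmonic k by rewrite mulr_ge0// harmonic_ge0.
have -> : 1 = fine (\int[P]_w 1)%E :> R.
  by rewrite integral_probability1.
apply: fine_cvg; rewrite fineK; last first.
  by rewrite integral_probability1.
apply: (@dominated_cvg _ _ _ P setT measurableT _ _ (cst 1%E)) => //.
- move=> n; exact: measurable_laplace.
- move=> w _; apply: cvg_EFin; first exact: nearW.
  rewrite -[X in _ --> X]expR0; apply: continuous_cvg; first exact: continuous_expR.
  rewrite -[X in _ --> X]oppr0; apply: cvgN.
  rewrite [X in _ --> X](_ : 0 = t * 0 * (V w)%:R); last by rewrite mulr0 mul0r.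
  apply: cvgM; last exact: cvg_cst.
  by apply: cvgM; [exact: cvg_cst|exact: cvg_harmonic].
- exact: finite_measure_integrable_cst.
- by move=> k w _; rewrite /= ger0_norm ?expR_ge0// lee_fin expRN_le1.
Qed.

(** A difference quotient of the Laplace transform at 0. Since [1 - exp(- y) <= y], the integrands
    are dominated by [t V], which is integrable as soon as the mean is finite. *)
Lemma cvg_laplace_derivative V t mu : measurable_fun [set: T] V -> 0 <= t ->
  (\int[P]_w ((V w)%:R%:E) = mu%:E)%E ->
  k.+1%:R * (1 - laplace V (t * harmonic k)) @[k --> \oo] --> t * mu.
Proof.
move=> mV t0 EV; have tk0 k : 0 <= t * harmonic k by rewrite mulr_ge0// harmonic_ge0.
have mVR : measurable_fun [set: T] (fun w => (V w)%:R : R).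
  exact: (@measurable_fun_nat _ _ _ V (fun m => m%:R)).
pose f k w : \bar R := (k.+1%:R * (1 - expR (- (t * harmonic k * (V w)%:R))))%:E.
have mf k : measurable_fun [set: T] (f k).
  apply/measurable_EFinP; exact: (@measurable_fun_nat _ _ _ V
    (fun m => k.+1%:R * (1 - expR (- (t * harmonic k * m%:R))))).
have tEV : (\int[P]_w (t * (V w)%:R)%:E = (t * mu)%:E)%E.
  under eq_integral do rewrite EFinM.
  rewrite ge0_integralZl ?lee_fin//; first by rewrite EV.
    exact/measurable_EFinP.
have fE k : (\int[P]_w f k w)%E = (k.+1%:R * (1 - laplace V (t * harmonic k)))%:E.
  rewrite /f; under eq_integral do rewrite EFinM.
  rewrite ge0_integralZl ?lee_fin//; first by rewrite integral_subr_laplace.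
  - apply/measurable_EFinP; exact: (@measurable_fun_nat _ _ _ V
      (fun m => 1 - expR (- (t * harmonic k * m%:R)))).
  - by move=> w _; rewrite lee_fin subr_ge0 expRN_le1.
have : (\int[P]_w f k w)%E @[k --> \oo] --> (\int[P]_w (t * (V w)%:R)%:E)%E.
  apply: (@dominated_cvg _ _ _ P setT measurableT f _
    (fun w => (t * (V w)%:R)%:E)) => //.
  - move=> w _; apply: cvg_EFin; first exact: nearW.
    have := @cvg_expRN_scaled R (t * (V w)%:R); rewrite mulr_ge0// => /(_ isT).
    by apply: cvg_trans; apply: near_eq_cvg; near=> k => /=; rewrite mulrAC.
  - apply/integrableP; split; first by apply/measurable_EFinP; exact: measurable_funM.
    under eq_integral do rewrite gee0_abs ?lee_fin ?mulr_ge0//.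
    by rewrite tEV ltry.
  - move=> k w _; have k0 : 0 < k.+1%:R :> R by rewrite ltr0n.
    have V0 : 0 <= t * (V w)%:R by rewrite mulr_ge0.
    rewrite /f gee0_abs ?lee_fin ?mulr_ge0 ?subr_ge0 ?expRN_le1// ?ler0n//.
    rewrite mulrAC.
    have /andP[_ /(ler_wpM2l (ltW k0))] :=
      expRN_bounds (mulr_ge0 V0 (@harmonic_ge0 R k)).
    by move=> /le_trans; apply; rewrite mulrCA /harmonic/= divff ?mulr1// gt_eqF.
rewrite tEV; under eq_fun do rewrite fE.
by move=> /fine_cvg.
Unshelve. all: by end_near. Qed.

End LaplaceTransform.

Section WeakLaw.
Context (d : measure_display) (T : measurableType d) (R : realType)
  (P : probability T R) (W : nat -> T -> nat) (mu : R).
Hypothesis mW : forall i, measurable_fun [set: T] (W i).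
Hypothesis indW : forall j, indep_upto P W j setT.
Hypothesis idW : forall i A, (0 < i)%N -> P (W i @^-1` A) = P (W 1%N @^-1` A).
Hypothesis EW : (\int[P]_w ((W 1%N w)%:R%:E) = mu%:E)%E.

(** The [k.+1] terms include the initial [W 0], so that for cycle lengths the sum is [S k]. *)
Definition partial_sum k w : nat := (\sum_(i < k.+1) W i w)%N.

Lemma measurable_partial_sum k : measurable_fun [set: T] (partial_sum k).
Proof.
rewrite /partial_sum; elim: k => [|k IHk].
  by under eq_fun do rewrite big_ord1; exact: mW.
under eq_fun do rewrite big_ord_recr/=.
exact: measurable_fun_addn.
Qed.

Lemma integral_identically_distributed i (g : nat -> R) : (0 < i)%N ->
  (forall m, 0 <= g m) ->
  (\int[P]_w (g (W i w))%:E = \int[P]_w (g (W 1%N w))%:E)%E.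
Proof.
move=> i0 g0.
have E j : (\int[P]_w (g (W j w))%:E =
    \sum_(m <oo) (g m)%:E * P (W j @^-1` [set m]))%E.
  rewrite (integral_slices P mW j measurableT)//; first last.
  - by move=> w; rewrite lee_fin.
  - by apply/measurable_EFinP; exact: measurable_fun_nat.
  apply: eq_eseriesr => m _; rewrite setIT.
  transitivity (\int[P]_(w in W j @^-1` [set m]) cst (g m)%:E w)%E.
    by apply: eq_integral => w; rewrite inE => /= ->.
  by rewrite integral_cst// -[X in measurable X]setTI; exact: mW.
by rewrite !E; apply: eq_eseriesr => m _; rewrite idW.
Qed.

Lemma laplace_partial_sum s k : 0 <= s ->
  laplace P (partial_sum k) s = laplace P (W 0%N) s * laplace P (W 1%N) s ^+ k.
Proof.
move=> s0; apply: EFin_inj; rewrite -laplaceE//; last exact: measurable_partial_sum.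
have e1 m : expR (- (s * m%:R)) <= 1.
  by rewrite -expR0 ler_expR oppr_le0 mulr_ge0.
have := @indep_prod_integral _ _ _ P W (fun m => expR (- (s * m%:R))) mW
  (fun m => expR_ge0 _) e1 k.+1 setT measurableT (indW k.+1).
rewrite probability_setT mule1 big_ord_recl/= (laplaceE _ (mW 0%N))//.
have id1 (i : 'I_k) : (\int[P]_w (expR (- (s * (W (lift ord0 i) w)%:R)))%:E =
    (laplace P (W 1%N) s)%:E)%E.
  rewrite (@integral_identically_distributed _ (fun m => expR (- (s * m%:R))))//.
  exact: laplaceE.
under [in X in _ = X -> _]eq_bigr do rewrite id1.
rewrite prodEFin big_const_ord iter_mulr mulr1 -EFinM => <-.
apply: eq_integral => w _; congr _%:E.
by rewrite -expR_sum sumrN -mulr_sumr -natr_sum.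
Qed.

(** [W 0] has a law of its own; its single factor is taken at arguments tending to 0 and therefore
    tends to 1. *)
Lemma cvg_laplace_partial_sum t : 0 <= t ->
  laplace P (partial_sum k.+1) (t * harmonic k) @[k --> \oo] --> expR (- (t * mu)).
Proof.
move=> t0; have tk0 k : 0 <= t * harmonic k by rewrite mulr_ge0// harmonic_ge0.
under eq_fun do rewrite laplace_partial_sum//.
rewrite -(mul1r (expR _)); apply: cvgM; first exact: cvg_laplace1.
apply: cvg_exprn_expRN; first by move=> k; exact: laplace_le1.
exact: cvg_laplace_derivative.
Qed.

Let v k w : R := expR (- (harmonic k * (partial_sum k.+1 w)%:R)).

Let measurable_v k : measurable_fun [set: T] (v k).
Proof.
exact: (@measurable_fun_nat _ _ _ _ (fun n => expR (- (harmonic k * n%:R)))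
  (measurable_partial_sum k.+1)).
Qed.

Let measurable_sqr k (m : R) :
  measurable_fun [set: T] (fun w => ((v k w - m) ^+ 2)%:E).
Proof.
apply/measurable_EFinP/measurable_funX.
by apply: measurable_funB => //; exact: measurable_v.
Qed.

(* The law of large numbers follows from convergence in L^2 of [v k], that is
   of [exp (- S_n / n)], to [exp (- mu)]: unlike for [S_n / n] itself, this only
   needs a first moment. *)
Lemma second_moment k (m : R) : 0 <= m ->
  (\int[P]_w ((v k w - m) ^+ 2)%:E)%E =
  (laplace P (partial_sum k.+1) (2 * harmonic k) -
    2 * m * laplace P (partial_sum k.+1) (1 * harmonic k) + m ^+ 2)%:E.
Proof.
move=> m0; have mS := measurable_partial_sum k.+1; have mv := measurable_v k.
have h0 := @harmonic_ge0 R k.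
have L1 : (\int[P]_w (v k w)%:E)%E = (laplace P (partial_sum k.+1) (1 * harmonic k))%:E.
  by rewrite -laplaceE ?mul1r.
have L2 : (\int[P]_w (v k w ^+ 2)%:E)%E =
    (laplace P (partial_sum k.+1) (2 * harmonic k))%:E.
  rewrite -laplaceE ?mulr_ge0//; apply: eq_integral => w _; congr _%:E.
  by rewrite /v -expRM_natl mulrN mulrA.
have : ((\int[P]_w ((v k w - m) ^+ 2)%:E) + (2 * m)%:E * \int[P]_w (v k w)%:E =
    (\int[P]_w (v k w ^+ 2)%:E) + (m ^+ 2)%:E)%E.
  have cst_int : (\int[P]_w (m ^+ 2)%:E = (m ^+ 2)%:E)%E.
    by rewrite integral_cst//= probability_setT mule1.
  have mv2 : measurable_fun [set: T] (fun w => (v k w ^+ 2)%:E).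
    by apply/measurable_EFinP; exact: measurable_funX.
  rewrite -[in RHS]cst_int -ge0_integralZl//; first last.
  - by rewrite lee_fin mulr_ge0.
  - by move=> w _; rewrite lee_fin expR_ge0.
  - exact/measurable_EFinP.
  have s0 w : setT w -> (0 <= ((v k w - m) ^+ 2)%:E)%E.
    by move=> _; rewrite lee_fin sqr_ge0.
  have mv0 w : setT w -> (0 <= (2 * m)%:E * (v k w)%:E)%E.
    by move=> _; rewrite lee_fin !mulr_ge0// expR_ge0.
  have v0 w : setT w -> (0 <= (v k w ^+ 2)%:E)%E.
    by move=> _; rewrite lee_fin sqr_ge0.
  have ms := measurable_sqr k m.
  have mmv : measurable_fun [set: T] (fun w => (2 * m)%:E * (v k w)%:E)%E.
    by apply/measurable_EFinP; exact: measurable_funM.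
  rewrite -!ge0_integralD//.
    by apply: eq_integral => w _; rewrite -EFinM -!EFinD; congr _%:E; ring.
  by move=> w _; rewrite lee_fin sqr_ge0.
rewrite L1 L2 -EFinM -EFinD.
set c := 2 * m * laplace _ _ _; move=> /(congr1 (fun x => x - c%:E)%E).
by rewrite addeK// => ->; rewrite -EFinB; congr _%:E; ring.
Qed.

Lemma cvg_second_moment :
  (\int[P]_w ((v k w - expR (- mu)) ^+ 2)%:E)%E @[k --> \oo] --> 0%E.
Proof.
under eq_fun do rewrite second_moment ?expR_ge0//.
apply: cvg_EFin; first exact: nearW.
have -> : 0 = expR (- (2 * mu)) - 2 * expR (- mu) * expR (- (1 * mu)) +
    expR (- mu) ^+ 2.
  by rewrite -mulrN expRM_natl mul1r; ring.
apply: cvgD; last exact: cvg_cst.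
apply: cvgB; first exact: cvg_laplace_partial_sum.
by apply: cvgM; [exact: cvg_cst|exact: cvg_laplace_partial_sum].
Qed.

(** Chebyshev's inequality for [v k]: as [exp] is strictly monotone, a deviation of the average by
    more than [eps] moves [v k] away from [exp(- mu)] by at least [r]. *)
Lemma weak_law (eps del : R) : 0 < eps -> 0 < del -> \forall k \near \oo,
  (P [set w | (eps * k%:R < `|(partial_sum k w)%:R - mu * k%:R|)%R] <= del%:E)%E.
Proof.
move=> eps0 del0; set m := expR (- mu).
have a0 : 0 < m - expR (- (mu + eps)) by rewrite subr_gt0 ltr_expR; lra.
have b0 : 0 < expR (- (mu - eps)) - m by rewrite subr_gt0 ltr_expR; lra.
set r := Num.min (m - expR (- (mu + eps))) (expR (- (mu - eps)) - m).
have r0 : 0 < r by rewrite lt_min a0.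
have r20 : 0 < r ^+ 2 by rewrite exprn_gt0.
have delr : 0 < del * r ^+ 2 by rewrite mulr_gt0.
have /fine_cvgP[_ /cvgrPdist_le/(_ _ delr)] := cvg_second_moment.
(* [v k] belongs to the partial sum of index [k.+1], divided by [k.+1]. *)
case=> N _ NP; exists N.+1 => // -[//|k] /= Nk.
have := NP k Nk; rewrite /= sub0r normrN => /(le_trans (ler_norm _)).
rewrite -lee_fin fineK; last by rewrite second_moment ?expR_ge0.
rewrite -/m => moment.
set A := [set w | _]; pose B := [set w | r <= `|v k w - m|].
have mpre (C : set nat) : measurable (partial_sum k.+1 @^-1` C).
  by rewrite -[X in measurable X]setTI; exact: measurable_partial_sum.
have mA : measurable A.
  exact: (mpre [set n | eps * k.+1%:R < `|n%:R - mu * k.+1%:R|]).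
have mB : measurable B.
  exact: (mpre [set n | r <= `|expR (- (harmonic k * n%:R)) - m|]).
have AB : A `<=` B.
  move=> w; rewrite /A /B /v /=; set x : R := (partial_sum _ w)%:R.
  have k0 : 0 < k.+1%:R :> R by rewrite ltr0n.
  have h0 := @harmonic_gt0 R k.
  have hk : harmonic k * k.+1%:R = 1 :> R.
    by rewrite mulrC /harmonic/= divff// gt_eqF.
  rewrite ltr_normr => /orP[] xk.
    have : harmonic k * ((mu + eps) * k.+1%:R) < harmonic k * x.
      by rewrite ltr_pM2l//; lra.
    rewrite mulrCA hk mulr1 -ltrN2 -ltr_expR => vlt.
    rewrite distrC (le_trans _ (ler_norm _))//.
    rewrite (@le_trans _ _ (m - expR (- (mu + eps))))//.
      by rewrite ge_min lexx.
    by rewrite lerD2l lerN2 ltW.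
  have : harmonic k * x < harmonic k * ((mu - eps) * k.+1%:R).
    by rewrite ltr_pM2l//; lra.
  rewrite mulrCA hk mulr1 -ltrN2 -ltr_expR => vlt.
  rewrite (le_trans _ (ler_norm _))//.
  rewrite (@le_trans _ _ (expR (- (mu - eps)) - m))//.
    by rewrite ge_min lexx orbT.
  by rewrite lerD2r ltW.
apply: (le_trans (le_measure P _ _ AB)); rewrite ?inE//.
rewrite -(@lee_pmul2l _ (r ^+ 2)%:E) ?lte_fin// -EFinM (mulrC (r ^+ 2)).
apply: le_trans moment.
apply: (@le_trans _ _ (\int[P]_(w in B) ((v k w - m) ^+ 2)%:E)%E).
  rewrite -integral_cst//; apply: ge0_le_integral => //.
  - by move=> w _; rewrite lee_fin ltW.
  - by apply: measurable_funTS; exact: measurable_sqr.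
  - move=> w /= Bw; rewrite lee_fin -[leRHS]real_normK ?num_real//.
    by rewrite lerXn2r ?nnegrE ?normr_ge0// ltW.
apply: ge0_subset_integral => //.
by move=> w _; rewrite lee_fin sqr_ge0.
Qed.

End WeakLaw.

(** * Regenerative maxima *)

Section RunningMaxima.
Context (R : realType).
Implicit Types (x : nat -> R) (u : R).

Lemma max_on_leP x a b u : (a < b)%N ->
  (max_on x a b <= u) <-> (forall j, (a <= j < b)%N -> x j <= u).
Proof.
move=> ab; have -> : (max_on x a b <= u) =
    (x a <= u) && all (fun j => x j <= u) (index_iota a b).
  rewrite /max_on; elim: index_iota => [|j s IHs]; first by rewrite big_nil andbT.
  by rewrite big_cons ge_max IHs/= andbCA.
split.
- by move=> /andP[_ /allP xu] j jab; apply: xu; rewrite mem_index_iota.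
- move=> xu; rewrite xu ?leqnn//=; apply/allP => j; rewrite mem_index_iota.
  exact: xu.
Qed.

End RunningMaxima.

Section CountableGluing.
Context (d d' : measure_display) (T : measurableType d) (U : measurableType d').

(** Splitting along the countably many values of [N] handles the random ends of the cycles. *)
Lemma measurable_fun_glue (N : T -> nat) (f : nat -> T -> U) :
  measurable_fun [set: T] N -> (forall k, measurable_fun [set: T] (f k)) ->
  measurable_fun [set: T] (fun w => f (N w) w).
Proof.
move=> mN mf _ B mB; rewrite setTI.
have -> : (fun w => f (N w) w) @^-1` B =
    \bigcup_k (N @^-1` [set k] `&` f k @^-1` B).
  apply/seteqP; split=> [w Bw|w [k _ [/= Nw]]]; first by exists (N w).
  by rewrite /= Nw.
apply: bigcup_measurable => k _; apply: measurableI.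
- by rewrite -[X in measurable X]setTI; exact: mN.
- by rewrite -[X in measurable X]setTI; exact: mf.
Qed.

End CountableGluing.

Section RegenerativeProcess.
Context (d : measure_display) (T : measurableType d) (R : realType)
  (P : probability T R) (X : nat -> {RV P >-> R}) (S : nat -> {RV P >-> nat}).

Lemma measurable_max_on (Y : nat -> T -> R) a b :
  (forall i, measurable_fun [set: T] (Y i)) ->
  measurable_fun [set: T] (fun w => max_on (Y ^~ w) a b).
Proof.
move=> mY; rewrite /max_on; elim: index_iota => [|j s IHs].
  by under eq_fun do rewrite big_nil; exact: mY.
by under eq_fun do rewrite big_cons; exact: measurable_maxr.
Qed.

Lemma measurable_le_cst (f : T -> R) u :
  measurable_fun [set: T] f -> measurable [set w | f w <= u].
Proof.
move=> mf; rewrite (_ : [set w | _] = f @^-1` `]-oo, u]); last first.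
  by apply/seteqP; split=> w /=; rewrite in_itv.
rewrite -[X in measurable X]setTI; apply: mf => //; exact: measurable_itv.
Qed.

Lemma measurable_cycle_length i : measurable_fun [set: T] (cycle_length S i).
Proof.
case: i => [|j]; first exact: measurable_funPT.
apply: (@measurable_fun_glue _ _ _ _ (S j.+1) (fun b w => b - S j w)%N) => [|b].
  exact: measurable_funPT.
apply: (@measurable_fun_glue _ _ _ _ (S j) (fun a w => b - a)%N) => [|a].
  exact: measurable_funPT.
exact: measurable_cst.
Qed.

Lemma measurable_cycle_max i : measurable_fun [set: T] (cycle_max X S i).
Proof.
have mX j : measurable_fun [set: T] (X j) by exact: measurable_funPT.
case: i => [|j].
  apply: (@measurable_fun_glue _ _ _ _ (S 0%N)
    (fun b w => max_on (X ^~ w) 0 b)) => [|b].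
    exact: measurable_funPT.
  exact: measurable_max_on.
apply: (@measurable_fun_glue _ _ _ _ (S j.+1)
  (fun b w => max_on (X ^~ w) (S j w) b)) => [|b].
  exact: measurable_funPT.
apply: (@measurable_fun_glue _ _ _ _ (S j)
  (fun a w => max_on (X ^~ w) a b)) => [|a].
  exact: measurable_funPT.
exact: measurable_max_on.
Qed.

Lemma mutually_independent_ord d' (T' : measurableType d') (Z : nat -> T -> T')
    (k : nat) (B : nat -> set T') : mutually_independent P Z ->
  (forall i, measurable (B i)) ->
  P (\bigcap_(i in `I_k) Z i @^-1` B i) = (\prod_(i < k) P (Z i @^-1` B i))%E.
Proof.
move=> indZ mB; have := indZ [fset i in iota 0 k]%fset B (fun i _ => mB i).
have -> : [set` [fset i in iota 0 k]%fset] = `I_k.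
  by apply/seteqP; split=> i /=; rewrite !inE mem_iota add0n.
move=> ->; rewrite -(big_mkord xpredT (fun i => P (Z i @^-1` B i))).
apply: perm_big; apply: uniq_perm; [exact: fset_uniq|exact: iota_uniq|].
by move=> i; rewrite !inE mem_index_iota mem_iota.
Qed.

Section Regeneration.
Hypothesis reg : regenerative X S.

Let Z i w := (cycle_length S i w, cycle_max X S i w).

Lemma indep_upto_cycle_length j : indep_upto P (cycle_length S) j setT.
Proof.
have [_ _ indZ _] := reg; move=> B; rewrite setIT probability_setT mule1.
have := @mutually_independent_ord _ _ Z j (fun i => B i `*` setT) indZ.
have E i : Z i @^-1` (B i `*` setT) = cycle_length S i @^-1` B i.
  by apply/seteqP; split=> w //= -[].
under eq_bigcapr do rewrite E; under eq_bigr do rewrite E.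
by apply => i; exact: measurableX.
Qed.

Lemma cycle_length_law i (A : set nat) : (0 < i)%N ->
  P (cycle_length S i @^-1` A) = P (cycle_length S 1 @^-1` A).
Proof.
have [_ _ _ idZ] := reg => /idZ/(_ (A `*` setT)).
have E j : Z j @^-1` (A `*` setT) = cycle_length S j @^-1` A.
  by apply/seteqP; split=> w //= -[].
by rewrite !E; apply; exact: measurableX.
Qed.

Lemma prob_cycle_max_le k (u : R) :
  P [set w | forall i, (0 < i <= k)%N -> cycle_max X S i w <= u] =
  (distr_fun P (cycle_max X S 1) u ^+ k)%:E.
Proof.
have [_ _ indZ idZ] := reg.
(* Cycle 0 has another law and is left unconstrained; it contributes a factor 1. *)
pose B i : set (nat * R) := if i is 0 then setT else setT `*` `]-oo, u].
have mB i : measurable (B i).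
  case: i => [|i]; first exact: measurableT.
  by apply: measurableX => //; exact: measurable_itv.
have E i : Z i.+1 @^-1` B i.+1 = [set w | cycle_max X S i.+1 w <= u].
  by apply/seteqP; split=> w /=; rewrite in_itv/=; [case|move=> h; split].
have PE i : P (Z i.+1 @^-1` B i.+1) = (distr_fun P (cycle_max X S 1) u)%:E.
  rewrite (idZ i.+1 isT (B i.+1) (mB _)) (E 0%N) fineK// fin_num_measure//.
  exact: measurable_le_cst (@measurable_cycle_max 1).
have := @mutually_independent_ord _ _ Z k.+1 B indZ mB.
rewrite big_ord_recl/= preimage_setT probability_setT mul1e.
under [in X in _ = X -> _]eq_bigr do rewrite PE.
rewrite prodEFin big_const_ord iter_mulr mulr1 => <-; congr (P _).
have EE i w : (Z i.+1 @^-1` B i.+1) w <-> cycle_max X S i.+1 w <= u by rewrite E.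
apply/seteqP; split=> w /= Yu.
  case=> [_|i ik]; first by [].
  exact: (EE i w).2 (Yu i.+1 ik).
by case=> // i ik; exact: (EE i w).1 (Yu i.+1 ik).
Qed.

Lemma partial_sum_cycle_length k w : partial_sum (cycle_length S) k w = S k w.
Proof.
have [_ Slt _ _] := reg; elim: k => [|k IHk]; first by rewrite /partial_sum big_ord1.
rewrite /partial_sum big_ord_recr/= -/(partial_sum _ _ _) IHk.
by rewrite subnKC// ltnW.
Qed.

(** The cycles [0, ..., k] tile the indices below [S k w]. *)
Lemma cycle_max_leP k (u : R) w :
  (forall i, (i <= k)%N -> cycle_max X S i w <= u) <->
  (forall j, (j < S k w)%N -> X j w <= u).
Proof.
have [S0 Slt _ _] := reg; elim: k => [|k IHk]; split.
- move=> /(_ 0%N isT)/max_on_leP => /(_ (S0 w)) h j jS; exact: h.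
- by move=> h [|//] _; apply/max_on_leP => // j; exact: h.
- move=> h j jS; have [jSk|Skj] := ltnP j (S k w).
    by apply: IHk.1 jSk => i ik; apply: h; rewrite ltnW.
  have /max_on_leP : cycle_max X S k.+1 w <= u by exact: h.
  by apply => //; rewrite Skj.
- move=> h i; rewrite leq_eqVlt => /orP[/eqP ->|]; last first.
    rewrite ltnS; apply: IHk.2 => j jSk; apply: h.
    exact: ltn_trans jSk (Slt _ _).
  by apply/max_on_leP => // j /andP[_]; exact: h.
Qed.

End Regeneration.
End RegenerativeProcess.

(** * Sandwiching the law of the maximum *)

Section RootzenApproximation.
Context (d : measure_display) (T : measurableType d) (R : realType)
  (P : probability T R) (X : nat -> {RV P >-> R}) (S : nat -> {RV P >-> nat}).
Local Notation Y := (cycle_max X S).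
Local Notation H := (distr_fun P (Y 1%N)).

Definition initial_le (n : nat) (u : R) : set T :=
  [set w | forall j, (j < n)%N -> X j w <= u].

Lemma measurable_initial_le n u : measurable (initial_le n u).
Proof.
rewrite (_ : initial_le n u = \bigcap_(j in `I_n) [set w | X j w <= u])//.
apply: bigcap_measurableType => j _.
by apply: measurable_le_cst; exact: measurable_funPT.
Qed.

(** [M_n] starts at index 1 but the cycles start at index 0; stationarity provides the shift by
    one. *)
Lemma stationary_max_on n u : strictly_stationary X -> (0 < n)%N ->
  P [set w | max_on (X ^~ w) 1 n.+1 <= u] = P (initial_le n u).
Proof.
move=> stX n0; pose B := [set t : n.-tuple R | forall i, tnth t i <= u].
have mB : measurable B.
  rewrite (_ : B = \bigcap_(i in [set: 'I_n]) (@tnth _ R ^~ i) @^-1` `]-oo, u]).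
    apply: fin_bigcap_measurable => // i _.
    rewrite -[X in measurable X]setTI; apply: measurable_tnth => //.
  apply/seteqP; split=> t /=.
    by move=> Bt i _ /=; rewrite in_itv/=; exact: Bt.
  by move=> Bt i; have := Bt i I; rewrite /= in_itv.
rewrite (_ : [set w | _] = [set w | B [tuple X (1 + i)%N w | i < n]]).
  rewrite stX//; congr (P _); apply/seteqP; split=> w /=.
    by move=> Bw j jn; have := Bw (Ordinal jn); rewrite tnth_mktuple.
  by move=> Xu i; rewrite tnth_mktuple; exact: Xu.
apply/seteqP; split=> w /=.
  move=> /max_on_leP Xu i; rewrite tnth_mktuple; apply: Xu => //.
  by rewrite !add1n !ltnS/=.
move=> Bw; apply/max_on_leP => // -[//|j] jn.
by have := Bw (Ordinal (jn : (j < n)%N)); rewrite tnth_mktuple.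
Qed.

Section Sandwich.
Variable mu : R.
Hypothesis reg : regenerative X S.
Hypothesis EW : (\int[P]_w ((cycle_length S 1 w)%:R%:E) = mu%:E)%E.
Hypothesis Y0small :
  P [set w | Y 0%N w > max_on (Y ^~ w) 1 n.+1] @[n --> \oo] --> 0%E.

(** If [S k <= n], a bound on the first [n] variables bounds the cycle maxima up to [k]. Conversely,
    if [n <= S k] and [Y_0] is dominated by the later maxima, bounds on [Y_1, ..., Y_k] suffice. One
    [del] pays for [S k] lying on the wrong side of [n], a second one for [Y_0]. *)
Lemma sandwich (eps del : R) : 0 < eps -> 0 < del -> \forall k \near \oo,
  forall n u,
    ((mu + eps) * k%:R <= n%:R ->
      fine (P (initial_le n u)) <= H u ^+ k + del) /\
    (n%:R <= (mu - eps) * k%:R ->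
      H u ^+ k <= fine (P (initial_le n u)) + 2 * del).
Proof.
move=> eps0 del0.
have wl := weak_law (@measurable_cycle_length _ _ _ P S)
  (indep_upto_cycle_length reg) (cycle_length_law reg) EW eps0 del0.
have /fine_cvgP[Cfin /cvgrPdist_le/(_ _ del0) Cdel] := Y0small.
near=> k => n u.
have Ck : `|0 - fine (P [set w | Y 0%N w > max_on (Y ^~ w) 1 k.+1])| <= del.
  by near: k; exact: Cdel.
set L := [set w | eps * k%:R < `|(S k w)%:R - mu * k%:R|].
have PL : (P L <= del%:E)%E.
  have : (P [set w | (eps * k%:R <
      `|(partial_sum (cycle_length S) k w)%:R - mu * k%:R|)%R] <= del%:E)%E.
    by near: k.
  by under eq_set do rewrite (partial_sum_cycle_length reg).
set C := [set w | Y 0%N w > max_on (Y ^~ w) 1 k.+1].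
have mL : measurable L.
  rewrite -[L]setTI; have mS : measurable_fun [set: T] (S k) by exact: measurable_funPT.
  exact: (mS measurableT [set n : nat | eps * k%:R < `|n%:R - mu * k%:R|] I).
have mY i : measurable_fun [set: T] (Y i) by exact: measurable_cycle_max.
have mC : measurable C.
  rewrite (_ : C = ~` [set w | Y 0%N w - max_on (Y ^~ w) 1 k.+1 <= 0]).
    apply: measurableC; apply: measurable_le_cst; apply: measurable_funB => //.
    exact: measurable_max_on.
  by apply/seteqP; split=> w; rewrite /C/= subr_le0 ltNge => /negP.
have PC : (P C <= del%:E)%E.
  rewrite -(fineK (fin_num_measure P C mC)) lee_fin.
  by rewrite sub0r normrN in Ck; exact: le_trans (ler_norm _) Ck.
set A := initial_le n u; have mA := measurable_initial_le n u : measurable A.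
set B := [set w | forall i, (0 < i <= k)%N -> Y i w <= u].
have mB : measurable B.
  rewrite (_ : B = \bigcap_(i in [set i | (0 < i <= k)%N]) [set w | Y i w <= u])//.
  by apply: bigcap_measurableType => i _; exact: measurable_le_cst.
have PB : P B = (H u ^+ k)%:E := prob_cycle_max_le reg k u.
have PA : (fine (P A))%:E = P A by rewrite fineK// fin_num_measure.
split=> nk; rewrite -lee_fin EFinD PA -PB.
- have AB : A `<=` B `|` L.
    move=> w Aw; have [Sn|nS] := leqP (S k w) n.
      left=> i /andP[_ ik]; apply: (cycle_max_leP reg k u w).2 ik => j jS.
      exact/Aw/(leq_trans jS).
    right; rewrite /L /=; apply: lt_le_trans (ler_norm _).
    have : n%:R < (S k w)%:R :> R by rewrite ltr_nat.
    lra.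
  apply: (@le_trans _ _ (P B + P L)%E); last by rewrite leeD2l.
  apply: le_trans (measureU2 _ _ _) => //; apply: le_measure; rewrite ?inE//.
  exact: measurableU.
- have BA : B `<=` A `|` (C `|` L).
    move=> w Bw; have [YC|CY] := leP (Y 0%N w) (max_on (Y ^~ w) 1 k.+1); last first.
      by right; left.
    have Yu i : (i <= k)%N -> Y i w <= u.
      case: i => [_|i ik]; last exact: Bw.
      apply: (le_trans YC); apply/max_on_leP => //; rewrite ltnS.
      by near: k; exact: nbhs_infty_gt.
    have [nS|Sn] := leqP n (S k w).
      by left=> j jn; apply: (cycle_max_leP reg k u w).1 Yu _ _; exact: leq_trans nS.
    right; right; rewrite /L /= -normrN; apply: lt_le_trans (ler_norm _).
    have : (S k w)%:R < n%:R :> R by rewrite ltr_nat.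
    lra.
  apply: (@le_trans _ _ (P A + (P C + P L))%E).
    apply: (@le_trans _ _ (P (A `|` (C `|` L)))).
      by apply: le_measure; rewrite ?inE//; do 2 apply: measurableU => //.
    apply: le_trans (measureU2 _ _ _) _ => //; first exact: measurableU.
    by rewrite leeD2l// measureU2.
  rewrite leeD2l// (_ : 2 * del = del + del); last by ring.
  by rewrite EFinD leeD.
Unshelve. all: by end_near. Qed.

End Sandwich.
End RootzenApproximation.

(** * From integer numbers of cycles to the exponent n / mu *)

Section SandwichLimit.
Context (R : realType).

(** The target exponent is [x = n / mu]. Rounding [x / (1 + e)] down and [x / (1 - e)] up gives
    admissible numbers of cycles, both within a relative distance [3 * e] of [x];
    [powR_exponent_close] then compares the powers. *)
Lemma sandwich_close (p : nat -> R -> R) (H : R -> R) (mu : R) : 0 < mu ->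
  (forall u, 0 <= H u <= 1) ->
  (forall eps del : R, 0 < eps -> 0 < del -> \forall k \near \oo, forall n u,
    ((mu + eps) * k%:R <= n%:R -> p n u <= H u ^+ k + del) /\
    (n%:R <= (mu - eps) * k%:R -> H u ^+ k <= p n u + 2 * del)) ->
  forall eta, 0 < eta -> \forall n \near \oo, forall u,
    `|p n u - (H u `^ (1 / mu)) ^+ n| <= eta.
Proof.
move=> mu0 H01 sw eta eta0.
(* The worse side costs [2 * (eta / 4)] from the sandwich and [3 * e <= 3 * eta / 8] from the
   exponents, below [eta] in total. *)
have e0 : 0 < Num.min (1 / 2) (eta / 8) by rewrite lt_min; lra.
set e := Num.min _ _ in e0.
have e2 : e <= 1 / 2 by rewrite ge_min lexx.
have e8 : e <= eta / 8 by rewrite ge_min lexx orbT.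
have emu : 0 < e * mu by rewrite mulr_gt0.
have eta4 : 0 < eta / 4 by rewrite divr_gt0.
have [K _ swK] := sw _ _ emu eta4.
(* Beyond [M], rounding an exponent by 1 is a relative error of at most [e]; [x >= 2 * M] keeps both
   rounded exponents there. *)
pose M := maxn K (Num.trunc e^-1).+1.
have KM : (K <= M)%N by rewrite leq_maxl.
have eM : 1 <= e * M%:R.
  rewrite mulrC -ler_pdivrMr// div1r (le_trans (ltW (truncnS_gt _)))// ler_nat.
  by rewrite leq_maxr.
exists (Num.trunc (2 * mu * M%:R)).+1 => // n /= nM u.
have nmu : 2 * mu * M%:R <= n%:R.
  by rewrite (le_trans (ltW (truncnS_gt _)))// ler_nat.
set x := n%:R / mu.
have xmu : x * mu = n%:R by rewrite divfK// gt_eqF.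
have Mx : 2 * M%:R <= x by rewrite ler_pdivlMr// mulrAC.
have M0 : 0 < M%:R :> R by rewrite ltr0n leq_max ltn0Sn orbT.
have x0 : 0 < x by lra.
have /andP[H0 H1] := H01 u.
have -> : (H u `^ (1 / mu)) ^+ n = H u `^ x.
  by rewrite -powR_mulrn ?powR_ge0// -powRrM div1r mulrC.
have e1 : 0 < 1 + e by lra.
have e1' : 0 < 1 - e by lra.
have /andP[] := truncn_div_itv (ltW x0) e1; set k1 := Num.trunc _ => k1x xk1.
have Mk1 : (M <= k1)%N.
  rewrite leqNgt; apply/negP => k1M.
  have : k1.+1%:R * (1 + e) <= M%:R * 2 by rewrite ler_pM ?ler_nat//; lra.
  lra.
have Mk1R : M%:R <= k1%:R :> R by rewrite ler_nat.
have [up _] := swK k1 (leq_trans KM Mk1) n u.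
have {}up : p n u <= H u ^+ k1 + eta / 4.
  apply: up; rewrite -xmu (_ : _ * k1%:R = k1%:R * (1 + e) * mu); last by ring.
  by rewrite ler_pM2r.
have ek1 : 1 <= e * k1%:R by rewrite (le_trans eM)// ler_pM2l.
have k10 : 0 < k1%:R :> R by lra.
have k1x' : k1%:R <= x by nra.
have := powR_exponent_close k10 k1x' (H01 u).
have : (x - k1%:R) / k1%:R <= 3 * e.
  by rewrite ler_pdivrMr//; rewrite -natr1 in xk1; nra.
rewrite powR_mulrn// => b1; rewrite ler_norml => /andP[_ c1].
have /andP[] := truncn_div_itv (ltW x0) e1'; set t := Num.trunc _ => tx xt.
have xk2 : x <= t.+1%:R.
  by rewrite (le_trans (ltW xt))// ler_piMr//; lra.
have Kk2 : (K <= t.+1)%N.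
  rewrite -(ler_nat R) (le_trans _ xk2)// (le_trans _ Mx)//.
  by rewrite (@le_trans _ _ M%:R) ?ler_nat//; lra.
have [_ low] := swK t.+1 Kk2 n u.
have {}low : H u ^+ t.+1 <= p n u + 2 * (eta / 4).
  apply: low; rewrite -xmu (_ : _ * t.+1%:R = t.+1%:R * (1 - e) * mu); last by ring.
  by rewrite ler_pM2r// ltW.
have := powR_exponent_close x0 xk2 (H01 u).
have : (t.+1%:R - x) / x <= 3 * e.
  rewrite ler_pdivrMr// -natr1.
  have te : t%:R <= t%:R * ((1 - e) * (1 + 2 * e)) :> R.
    by rewrite ler_peMr//; nra.
  have : t%:R * (1 - e) * (1 + 2 * e) <= x * (1 + 2 * e) by rewrite ler_pM2r; lra.
  have : e * (2 * M%:R) <= e * x by rewrite ler_pM2l.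
  by rewrite mulrA in te; lra.
rewrite powR_mulrn// => b2; rewrite ler_norml => /andP[_ c2].
by rewrite ler_norml; apply/andP; split; lra.
Qed.

(** The bound by 1 makes [sup] a genuine least upper bound; on an unbounded set it is a default
    value. *)
Lemma cvg_sup_norm (f : nat -> R -> R) : (forall n u, `|f n u| <= 1) ->
  sup [set `|f n u| | u in [set: R]] @[n --> \oo] --> (0 : R) <->
  forall eps : R, 0 < eps -> \forall n \near \oo, forall u, `|f n u| <= eps.
Proof.
move=> f1; have ub n u : `|f n u| <= sup [set `|f n u| | u in [set: R]].
  apply: ub_le_sup; last by exists u.
  by exists 1 => _ [v _ <-].
split.
- move=> /cvgrPdist_le cv eps eps0; have := cv _ eps0; apply: filterS => n.
  rewrite sub0r normrN => supn u; rewrite (le_trans (ub n u))//.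
  exact: le_trans (ler_norm _) supn.
- move=> cv; apply/cvgrPdist_le => eps eps0; have := cv _ eps0.
  apply: filterS => n fn; rewrite sub0r normrN ger0_norm; last first.
    exact: le_trans (normr_ge0 _) (ub n 0).
  by apply: ge_sup => [|_ [u _ <-]]; [exists `|f n 0|; exists 0|exact: fn].
Qed.

End SandwichLimit.

Section DistributionFunction.
Context (d : measure_display) (T : measurableType d) (R : realType)
  (P : probability T R).

Lemma is_distr_fun_distr_fun (V : T -> R) : measurable_fun [set: T] V ->
  is_distr_fun (distr_fun P V).
Proof.
move=> mV; pose V' : {RV P >-> R} := HB.pack V (isMeasurableFun.Build _ _ _ _ V mV).
have E x : distr_fun P V x = fine (cdf V' x).
  by rewrite /distr_fun /cdf/= /distribution/=; congr (fine (P _)).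
have fin x : cdf V' x \is a fin_num by apply: fin_num_measure.
rewrite (_ : distr_fun P V = fine \o cdf V'); last exact/funext.
split.
- by move=> x y xy /=; rewrite fine_le//; exact: cdf_nondecreasing.
- move=> x; apply: fine_cvg; rewrite /= fineK//; exact: cdf_right_continuous.
- by apply: fine_cvg; exact: cvg_cdfNy0.
- by apply: fine_cvg; exact: cvg_cdfy1.
Qed.

End DistributionFunction.

(** * Phantom distribution functions *)

Section PhantomDistributionFunctions.
Context (d : measure_display) (T : measurableType d) (R : realType)
  (P : probability T R) (X : nat -> {RV P >-> R}) (S : nat -> {RV P >-> nat}).

Lemma phantom_distr_funP (F : R -> R) : is_distr_fun F ->
  phantom_distr_fun X F <-> forall eps : R, 0 < eps -> \forall n \near \oo,
    forall u, `|fine (P [set w | max_on (X ^~ w) 1 n.+1 <= u]) - F u ^+ n| <= eps.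
Proof.
move=> dF; rewrite -cvg_sup_norm; first by split=> [[]|].
move=> n u; have /andP[F0 F1] := distr_fun_itv u dF.
have Fn0 := exprn_ge0 n F0; have Fn1 := exprn_ile1 n F0 F1.
set A := [set w | _].
have mA : measurable A.
  by apply: measurable_le_cst; apply: measurable_max_on => i; exact: measurable_funPT.
have p0 : 0 <= fine (P A) by rewrite fine_ge0.
have p1 : fine (P A) <= 1.
  by rewrite -lee_fin fineK ?fin_num_measure// probability_le1.
by rewrite ler_norml; apply/andP; split; lra.
Qed.

(** Once one phantom is known, the triangle inequality eliminates the process: what remains compares
    two distribution functions. *)
Lemma phantom_close_powers (F G : R -> R) : is_distr_fun F ->
  phantom_distr_fun X G -> phantom_distr_fun X F <-> close_powers F G.
Proof.
move=> dF pG; have [dG _] := pG; rewrite phantom_distr_funP//.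
move: pG; rewrite phantom_distr_funP// => pG; split=> close eps eps0.
all: have eps2 : 0 < eps / 2 by rewrite divr_gt0.
all: have := pG _ eps2; have := close _ eps2; apply: filterS2 => n h1 h2 u.
all: move: (h1 u) (h2 u); rewrite !ler_norml => /andP[? ?] /andP[? ?].
all: by apply/andP; split; lra.
Qed.

(** Regeneration times are strictly increasing integers, so every cycle has length at least 1; this
    makes [1 / mu] a positive exponent. *)
Lemma mean_cycle_length (EW1 := 'E_P[fun w => (cycle_length S 1 w)%:R]%E) :
  regenerative X S -> (EW1 < +oo)%E ->
  1 <= fine EW1 /\
  (\int[P]_w ((cycle_length S 1 w)%:R%:E) = (fine EW1)%:E)%E.
Proof.
move=> reg; rewrite /EW1 unlock => EWy; have [_ Slt _ _] := reg.
have mW : measurable_fun [set: T] (fun w => ((cycle_length S 1 w)%:R : R)%:E).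
  apply/measurable_EFinP.
  exact: (@measurable_fun_nat _ _ _ _ (fun m => m%:R)
    (@measurable_cycle_length _ _ _ P S 1)).
have EW1_ge1 : (1 <= \int[P]_w ((cycle_length S 1 w)%:R%:E))%E.
  rewrite -[leLHS](@integral_probability1 _ _ _ P); apply: ge0_le_integral => //.
  by move=> w _; rewrite lee_fin ler1n subn_gt0.
have EWfin : (\int[P]_w ((cycle_length S 1 w)%:R%:E))%E \is a fin_num.
  by rewrite ge0_fin_numE// (le_trans _ EW1_ge1).
by rewrite fineK//; split=> //; rewrite -lee_fin fineK.
Qed.

End PhantomDistributionFunctions.

Theorem theorem3p1 (d : measure_display) (T : measurableType d) (R : realType)
    (P : probability T R) (X : nat -> {RV P >-> R})
    (S : nat -> {RV P >-> nat}) :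
  let EW1 : \bar R := 'E_P[fun w => (cycle_length S 1 w)%:R]%E in
  let Y := cycle_max X S in
  let H := distr_fun P (Y 1%N) in
  let G := fun x => H x `^ (1 / fine EW1) in
  strictly_stationary X ->
  regenerative X S ->
  (EW1 < +oo)%E ->
  P [set w | Y 0%N w > max_on (Y ^~ w) 1 n.+1] @[n --> \oo] --> 0%E ->
  ((exists F : R -> R, continuous F /\ phantom_distr_fun X F) <->
     regular_distr_fun H) /\
  (regular_distr_fun H -> phantom_distr_fun X G /\ regular_distr_fun G).
Proof.
move=> EW1 Y H G stX reg EWy Y0small.
have [mu1 EW] := mean_cycle_length reg EWy; rewrite -/EW1 in mu1 EW.
set mu := fine EW1 in mu1 EW.
have mu0 : 0 < mu by lra.
have imu0 : 0 < 1 / mu by rewrite divr_gt0.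
have dH : is_distr_fun H by apply: is_distr_fun_distr_fun; exact: measurable_cycle_max.
have dG : is_distr_fun G by exact: distr_fun_powR.
have F01 (F : R -> R) : is_distr_fun F -> forall u, 0 <= F u <= 1.
  by move=> dF u; exact: distr_fun_itv.
have pG : phantom_distr_fun X G.
  apply/phantom_distr_funP => // eps eps0.
  have := @sandwich_close R _ H mu mu0 (F01 _ dH) (sandwich reg EW Y0small) eps eps0.
  move=> close; near=> n => u; rewrite stationary_max_on//; last first.
    by near: n; exact: nbhs_infty_gt.
  by move: u; near: n.
have GH u : G u `^ mu = H u.
  have /andP[H0 _] := F01 _ dH u.
  by rewrite /G -powRrM div1r mulVf ?powRr1// gt_eqF.
have phantom_of_regular : regular_distr_fun H -> exists F : R -> R,
    [/\ continuous F, is_distr_fun F & phantom_distr_fun X F].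
  (* The approximation [F] is close to [H]; its power [1 / mu] is close to [G], hence a phantom. *)
  move=> /(tail_regularP dH)/(tail_regular_continuous dH)[F [cF dF FH]].
  have dF' := distr_fun_powR imu0 dF.
  exists (fun x => F x `^ (1 / mu)); split=> //.
    exact: continuous_distr_fun_powR.
  by apply/(phantom_close_powers dF' pG)/close_powers_powR => //; exact: F01.
split; last first.
  move=> /phantom_of_regular[F [cF dF pF]]; split=> //.
  (* Regularity passes from [H] to [G] through the continuous phantom, which is close to [G]. *)
  apply/(tail_regularP dG)/(close_powers_tail_regular cF dF dG).
  exact/(phantom_close_powers dF pG).
split=> [[F [cF pF]]|/phantom_of_regular[F [cF _ pF]]]; last by exists F.
have [dF _] := pF; apply/(tail_regularP dH).
(* A continuous phantom [F] is close to [G]; raising both to the power [mu] gives a continuous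
   function close to [H]. *)
apply: (@close_powers_tail_regular _ (fun x => F x `^ mu)) => //.
- exact: continuous_distr_fun_powR.
- exact: distr_fun_powR.
- rewrite (_ : H = fun x => G x `^ mu); last by apply/funext => u; rewrite GH.
  apply: close_powers_powR => //; [exact: F01|exact: F01|].
  exact/(phantom_close_powers dF pG).
Unshelve. all: by end_near. Qed.
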